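(* Let $g\geq 4$, $m=g-2$, and $$G_g=\langle a,b,c_1,\ldots,c_m\mid [a,b]c_1^2\cdots c_m^2=1\rangle$$ (the fundamental group of the closed non-orientable surface of genus $g$), where $[a,b]=aba^{-1}b^{-1}$. Let $H=\langle a,b\rangle\leq G_g$, $w=[a,b]$, $C=\langle w\rangle$ and $X=\{c_1,\ldots,c_m\}$. Then $H$ is hyperbolically embedded in $G_g$ with respect to $X$, i.e. $H\hookrightarrow_h(G_g,X)$. More precisely, the relative metric $\hat d$ on $H$ defined by $X$ satisfies $$\hat d(1,h)=\begin{cases}2m|k|, & h=w^k,\ k\in\mathbb{Z},\\ \infty, & h\in H\setminus C.\end{cases}$$
   Context: The subgroup $H$ is free on $a,b$, and $G_g$ is the amalgam $H*_CB$, where $B=\langle c_1,\ldots,c_m\rangle$ is free on $c_1,\dots,c_m$ and $H\cap B=C=\langle w\rangle=\langle c_1^2\cdots c_m^2\rangle$. Let $G$ be a group, $H\leq G$, $X\subseteq G$ with $G=\langle X\cup H\rangle$. $\Gamma(G,X\sqcup H)$ is the Cayley graph of $G$ with respect to the disjoint union alphabet $X\sqcup H$ (labels from $X$ and $H$ are distinguished even if they represent the same element), with edges of length one which may be traversed in either direction. $\Gamma(H,H)$ is the subgraph with vertex set $H$ and all $H$-labelled edges between vertices of $H$. A path in $\Gamma(G,X\sqcup H)$ is admissible if it uses no edge of $\Gamma(H,H)$ ($H$-labelled edges in other left cosets of $H$ are allowed). For $h,k\in H$, $\hat d(h,k)$ is the minimum length of an admissible path from $h$ to $k$, or $\infty$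 if none exists. One writes $H\hookrightarrow_h(G,X)$ if (a) $G=\langle X\cup H\rangle$; (b) $\Gamma(G,X\sqcup H)$ is Gromov hyperbolic; (c) every ball of finite radius in $(H,\hat d)$ is finite. *)

(* Defs.v *)
From HB Require Import structures.
From mathcomp Require Import all_boot all_order all_algebra generic_quotient.
From mathcomp Require Import mathcomp_extra boolp classical_sets functions.
From mathcomp Require Import cardinality set_interval reals ereal.

Set Implicit Arguments.
Unset Strict Implicit.
Unset Printing Implicit Defensive.

Import Order.TTheory GRing.Theory Num.Theory.
Local Open Scope classical_set_scope.
Local Open Scope ring_scope.

(* Groups given by generators and relators. *)

(* (s, false) stands for the letter s and (s, true) for its inverse. *)
Definition word (S : Type) := seq (S * bool).

Inductive word_eq (S : Type) (rel : set (word S)) : word S -> word S -> Prop :=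
| word_eq_refl u : word_eq rel u u
| word_eq_sym u v : word_eq rel u v -> word_eq rel v u
| word_eq_trans v u t : word_eq rel u v -> word_eq rel v t -> word_eq rel u t
| word_eq_cancel u v s b :
    word_eq rel (u ++ v) (u ++ (s, b) :: (s, ~~ b) :: v)
| word_eq_relator u v r : rel r -> word_eq rel (u ++ v) (u ++ r ++ v).

Definition word_inv (S : Type) (u : word S) : word S :=
  rev [seq (x.1, ~~ x.2) | x <- u].

Section WordEq.
Variables (S : Type) (rel : set (word S)).
Implicit Types u v t : word S.

Lemma word_eq_catl t u v : word_eq rel u v -> word_eq rel (t ++ u) (t ++ v).
Proof.
elim=> {u v} [u|u v _|v u x _ uv _|u v s b|u v r rr].
- exact: word_eq_refl.
- exact: word_eq_sym.
- exact: word_eq_trans.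
- by rewrite !catA; apply: word_eq_cancel.
- by rewrite !(catA t); apply: word_eq_relator.
Qed.

Lemma word_eq_catr t u v : word_eq rel u v -> word_eq rel (u ++ t) (v ++ t).
Proof.
elim=> {u v} [u|u v _|v u x _ uv _|u v s b|u v r rr].
- exact: word_eq_refl.
- exact: word_eq_sym.
- exact: word_eq_trans.
- by rewrite -!catA /=; apply: word_eq_cancel.
- by rewrite -!catA; apply: word_eq_relator.
Qed.

Lemma word_eq_cat u u' v v' :
  word_eq rel u u' -> word_eq rel v v' -> word_eq rel (u ++ v) (u' ++ v').
Proof.
move=> uu' vv'; apply: (@word_eq_trans _ _ (u' ++ v)).
- exact: word_eq_catr.
- exact: word_eq_catl.
Qed.

Lemma word_invK : involutive (@word_inv S).
Proof.
move=> u; rewrite /word_inv map_rev revK -map_comp -[RHS]map_id.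
by apply: eq_map => -[s b] /=; rewrite negbK.
Qed.

Lemma word_inv_cat u v : word_inv (u ++ v) = word_inv v ++ word_inv u.
Proof. by rewrite /word_inv map_cat rev_cat. Qed.

Lemma word_eq_mulV u : word_eq rel (u ++ word_inv u) [::].
Proof.
elim/last_ind: u => [|u [s b] IH]; first exact: word_eq_refl.
rewrite -cats1 word_inv_cat -catA /=; apply: word_eq_trans IH.
exact/word_eq_sym/word_eq_cancel.
Qed.

Lemma word_eq_Vmul u : word_eq rel (word_inv u ++ u) [::].
Proof. by rewrite -{2}[u]word_invK; apply: word_eq_mulV. Qed.

Lemma word_eq_inv u v : word_eq rel u v -> word_eq rel (word_inv u) (word_inv v).
Proof.
move=> uv; apply: (@word_eq_trans _ _ (word_inv u ++ v ++ word_inv v)).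
  rewrite -{1}[word_inv u]cats0; apply: word_eq_catl.
  exact/word_eq_sym/word_eq_mulV.
rewrite catA -{2}[word_inv v]cat0s; apply: word_eq_catr.
apply: word_eq_trans (word_eq_Vmul u); apply: word_eq_catl.
exact: word_eq_sym.
Qed.

End WordEq.

Section Presented.
Variables (S : choiceType) (rels : set (word S)).

Definition word_eqb (u v : word S) : bool := `[< word_eq rels u v >].

Lemma word_eqb_refl : reflexive word_eqb.
Proof. by move=> u; apply/asboolP/word_eq_refl. Qed.

Lemma word_eqb_sym : symmetric word_eqb.
Proof. by move=> u v; apply/asboolP/asboolP; apply: word_eq_sym. Qed.

Lemma word_eqb_trans : transitive word_eqb.
Proof.
by move=> v u t /asboolP uv /asboolP vt; apply/asboolP/(word_eq_trans uv).
Qed.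

Canonical word_eqb_equiv :=
  EquivRel word_eqb word_eqb_refl word_eqb_sym word_eqb_trans.

Local Open Scope quotient_scope.

Definition presented := {eq_quot word_eqb}.

HB.instance Definition _ := Choice.on presented.
HB.instance Definition _ := EqQuotient.on presented.

Definition presented_one : presented := \pi_presented [::].
Definition presented_mul (x y : presented) : presented :=
  \pi_presented (repr x ++ repr y).
Definition presented_inv (x : presented) : presented :=
  \pi_presented (word_inv (repr x)).

Lemma presented_piP u v :
  (\pi_presented u = \pi_presented v) <-> word_eq rels u v.
Proof. by split=> [/eqmodP/asboolP|uv] //; apply/eqmodP/asboolP. Qed.

Lemma presented_reprP u : word_eq rels (repr (\pi_presented u)) u.
Proof. by apply/presented_piP; rewrite reprK. Qed.

Lemma presented_mul_pi u v :
  presented_mul (\pi_presented u) (\pi_presented v) = \pi_presented (u ++ v).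
Proof. by apply/presented_piP/word_eq_cat; apply: presented_reprP. Qed.

Lemma presented_inv_pi u :
  presented_inv (\pi_presented u) = \pi_presented (word_inv u).
Proof. by apply/presented_piP/word_eq_inv/presented_reprP. Qed.

Lemma presented_mulA : associative presented_mul.
Proof.
move=> x y z; rewrite -[x]reprK -[y]reprK -[z]reprK.
move: (repr x) (repr y) (repr z) => u v t.
rewrite (presented_mul_pi v t) (presented_mul_pi u v).
by rewrite (presented_mul_pi u) (presented_mul_pi _ t) catA.
Qed.

Lemma presented_1mul : left_id presented_one presented_mul.
Proof. by move=> x; rewrite -[x]reprK /presented_one presented_mul_pi. Qed.

Lemma presented_mul1 : right_id presented_one presented_mul.
Proof. by move=> x; rewrite -[x]reprK /presented_one presented_mul_pi cats0. Qed.

Lemma presented_Vmul : left_inverse presented_one presented_inv presented_mul.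
Proof.
move=> x; rewrite -[x]reprK presented_inv_pi presented_mul_pi.
exact/presented_piP/word_eq_Vmul.
Qed.

Lemma presented_mulV : right_inverse presented_one presented_inv presented_mul.
Proof.
move=> x; rewrite -[x]reprK presented_inv_pi presented_mul_pi.
exact/presented_piP/word_eq_mulV.
Qed.

HB.instance Definition _ := isGroup.Build presented
  presented_mulA presented_1mul presented_mul1 presented_Vmul presented_mulV.

Definition presented_gen (s : S) : presented := \pi_presented [:: (s, false)].

End Presented.

Section Surface.
Variable m : nat.

Definition surface_letter : choiceType := (bool + 'I_m)%type.
Definition letter_a : surface_letter := inl false.
Definition letter_b : surface_letter := inl true.
Definition letter_c (i : 'I_m) : surface_letter := inr i.

(* [a, b] c_1^2 ... c_m^2, with [a, b] = a b a^-1 b^-1; the index i : 'I_m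
   stands for i + 1. *)
Definition surface_relator : word surface_letter :=
  [:: (letter_a, false); (letter_b, false); (letter_a, true); (letter_b, true)]
  ++ flatten [seq [:: (letter_c i, false); (letter_c i, false)] | i <- enum 'I_m].

(* The fundamental group of the closed non-orientable surface of genus m + 2. *)
Definition surface_group := presented [set surface_relator].

HB.instance Definition _ := Group.on surface_group.

Definition surface_a : surface_group := presented_gen _ letter_a.
Definition surface_b : surface_group := presented_gen _ letter_b.
Definition surface_c (i : 'I_m) : surface_group := presented_gen _ (letter_c i).

End Surface.

Section Subgroups.
Variable G : groupType.

Definition is_subgroup (H : set G) : Prop :=
  [/\ H 1%g, forall x y, H x -> H y -> H (x * y)%g & forall x, H x -> H x^-1%g].

Definition generated (A : set G) : set G := smallest is_subgroup A.

Definition expgz (x : G) (k : int) : G :=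
  match k with Posz n => (x ^+ n)%g | Negz n => (x ^- n.+1)%g end.

End Subgroups.

(* Graphs with vertex set V and edge set E, loops and multiple edges allowed.
   Edges have an orientation given by src and tgt, but may be traversed in
   both directions. *)
Section Graphs.
Variables (R : realType) (V E : Type) (src tgt : E -> V).

(* (e, false) traverses e from src e to tgt e, (e, true) is the reverse. *)
Definition step := (E * bool)%type.
Definition step_start (s : step) : V := if s.2 then tgt s.1 else src s.1.
Definition step_stop (s : step) : V := if s.2 then src s.1 else tgt s.1.

(* p is a path from u to v all of whose edges lie in A. *)
Fixpoint walk (A : set E) (u : V) (p : seq step) (v : V) : Prop :=
  if p is s :: p' then
    [/\ A s.1, step_start s = u & walk A (step_stop s) p' v]
  else u = v.

(* The minimal length of such a path, +oo if there is none. *)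
Definition walk_dist (A : set E) (u v : V) : \bar R :=
  ereal_inf [set (size p)%:R%:E | p in [set p | walk A u p v]].

(* The geometric realization, with edges of length one: Inside e t is the point
   of the open edge e at distance t from its origin. *)
Inductive graph_point := Vertex of V | Inside of E & (`]0, 1[%classic : set R).

Definition point_ends (p : graph_point) : set (V * R) :=
  match p with
  | Vertex v => [set (v, 0)]
  | Inside e t => [set (src e, val t); (tgt e, 1 - val t)]
  end.

Definition edge_dist (p q : graph_point) : set (\bar R) :=
  match p, q with
  | Inside e s, Inside f t => [set x | e = f /\ x = `|val s - val t|%:E]
  | _, _ => set0
  end.

(* The length metric: a shortest path from p to q either goes through an end of
   the edge of p and an end of the edge of q, or stays inside a single edge. *)
Definition point_dist (p q : graph_point) : \bar R :=
  ereal_inf ([set (x.2%:E + walk_dist setT x.1 y.1 + y.2%:E)%E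
               | x in point_ends p & y in point_ends q] `|` edge_dist p q).

End Graphs.

Section Hyperbolicity.
Variables (R : realType) (T : Type) (d : T -> T -> R).

Definition gromov_product (w x y : T) : R := (d x w + d y w - d x y) / 2.

Definition gromov_hyperbolic : Prop :=
  exists2 delta : R, 0 <= delta & forall w x y z : T,
    Num.min (gromov_product w x y) (gromov_product w y z) - delta
      <= gromov_product w x z.

End Hyperbolicity.

Section HyperbolicallyEmbedded.
Variables (R : realType) (G : groupType) (X H : set G).

(* The edges of the Cayley graph with respect to the disjoint union of X and H:
   (g, s) is the edge labelled s from g to g s. *)
Definition cayley_label := (X + H)%type.
Definition cayley_edge := (G * cayley_label)%type.

Definition label_val (s : cayley_label) : G :=
  match s with inl x => val x | inr h => val h end.

Definition cayley_src (e : cayley_edge) : G := e.1.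
Definition cayley_tgt (e : cayley_edge) : G := (e.1 * label_val e.2)%g.

Definition cayley_point := graph_point R G cayley_edge.

(* By convention fine +oo = 0, but all these distances are finite as soon as
   X `|` H generates G. *)
Definition cayley_dist (p q : cayley_point) : R :=
  fine (point_dist cayley_src cayley_tgt p q).

(* The edges of the subgraph Gamma(H, H). *)
Definition subgroup_edge : set cayley_edge :=
  [set e | [/\ exists h : H, e.2 = inr h, H (cayley_src e) & H (cayley_tgt e)]].

Definition relative_dist (h k : G) : \bar R :=
  walk_dist R cayley_src cayley_tgt (~` subgroup_edge) h k.

Definition hyperbolically_embedded : Prop :=
  [/\ is_subgroup H,
      generated (X `|` H) = [set: G],
      gromov_hyperbolic cayley_dist
    & forall (h : G) (r : R), H h ->
        finite_set [set k | H k /\ (relative_dist h k <= r%:E)%E]].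

End HyperbolicallyEmbedded.

(* Main.v *)
Require Import Defs.
From HB Require Import structures.
From mathcomp Require Import all_boot all_order all_algebra generic_quotient.
From mathcomp Require Import mathcomp_extra boolp classical_sets functions.
From mathcomp Require Import cardinality set_interval reals ereal.
From mathcomp Require Import zify lra.

(* G is the amalgam of H and the free group B on the c_i over <w>, so an element
   has a normal form: a product of alternating representatives of nontrivial
   cosets of <w> in H and in B, followed by an element of H or of B. The normal
   forms are obtained by letting G act on them from the right.

   Relative metric. Project G to the axis of <w> in the Cayley tree of B. Since
   m >= 2, two distinct translates of the axis share at most one edge, so an
   admissible edge moves the projection by at most 1, while w^k lies at
   distance 2m|k| from 1; and an admissible path never enters the part of G
   beyond H.

   Hyperbolicity. Listing the syllables of a normal form, those of B letter by
   letter, maps G to the rooted tree of lists in such a way that along every edge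
   of the Cayley graph the tree geodesic between the images of its ends stays
   close to that edge. Hence every path in the Cayley graph from x to y passes
   near the values of all nodes separating the images of x and y, which gives
   the four-point condition. *)

Set Implicit Arguments.
Unset Strict Implicit.
Unset Printing Implicit Defensive.

Import Order.TTheory GRing.Theory Num.Theory.
Local Open Scope classical_set_scope.
Local Open Scope ring_scope.

(** * Actions of presented groups and free orbits *)

Section PresentedAction.
Variables (S : choiceType) (rels : set (word S)).
Variables (T : Type) (act : T -> S * bool -> T).
Hypothesis actK : forall t s b, act (act t (s, b)) (s, ~~ b) = t.
Hypothesis act_rel : forall r t, rels r -> foldl act t r = t.

Lemma foldl_word_eq u v :
  word_eq rels u v -> forall t, foldl act t u = foldl act t v.
Proof.
elim=> {u v} [u t|u v _ IH t|u v t' _ IH1 _ IH2 t|u v s b t|u v r rr t].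
- by [].
- by rewrite IH.
- by rewrite IH1.
- by rewrite !foldl_cat /= actK.
- by rewrite !foldl_cat (act_rel _ rr).
Qed.

Definition presented_act t (x : presented rels) := foldl act t (repr x).

Lemma presented_act_pi t u :
  presented_act t (\pi_(presented rels) u)%qT = foldl act t u.
Proof. exact/foldl_word_eq/presented_reprP. Qed.

Lemma presented_act1 t : presented_act t 1%g = t.
Proof. exact: (presented_act_pi t [::]). Qed.

Lemma presented_actM t x y :
  presented_act t (x * y)%g = presented_act (presented_act t x) y.
Proof. by rewrite [LHS](presented_act_pi t) foldl_cat. Qed.

End PresentedAction.

(** * Integer iterates of a bijection *)

Section IntegerIteration.
Variables (T : Type) (f f' : T -> T).
Hypotheses (fK : cancel f f') (f'K : cancel f' f).

Definition iterz (k : int) (x : T) : T :=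
  match k with Posz j => iter j f x | Negz j => iter j.+1 f' x end.

Lemma iterzS k x : iterz (k + 1) x = f (iterz k x).
Proof.
case: k => j; first by rewrite addrC -intS.
rewrite [RHS]/= f'K NegzE; case: j => [|j] //.
by rewrite (_ : - _ + 1 = Negz j) // NegzE (intS j.+1) opprD addrAC addNr add0r.
Qed.

Lemma iterzP k x : iterz (k - 1) x = f' (iterz k x).
Proof. by rewrite -{2}(subrK 1 k) iterzS fK. Qed.

Lemma iterzD k l x : iterz (k + l) x = iterz k (iterz l x).
Proof.
elim/int_rect: k => [|j IH|j IH]; first by rewrite add0r.
  by rewrite -addn1 PoszD addrAC !iterzS IH.
by rewrite -addn1 PoszD opprD addrAC !iterzP IH.
Qed.

Lemma iterzK k : cancel (iterz k) (iterz (- k)).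
Proof. by move=> x; rewrite -iterzD addNr. Qed.

End IntegerIteration.

(** * Coordinates for a free action of the integers *)

Section FreeOrbits.
Variables (T : choiceType) (f f' : T -> T) (x0 : T).
Hypotheses (fK : cancel f f') (f'K : cancel f' f).
Local Notation rho := (iterz f f').
Hypothesis free : forall k x, rho k x = x -> k = 0.

(** The orbit of [x0] is represented by [x0] itself, so that later the coset $C$ gets the
    representative 1. Elsewhere [xget] is applied to the orbit as a set, which makes the choice
    constant on orbits. *)
Definition orbit_rep (x : T) : T :=
  if `[< exists k, x = rho k x0 >] then x0
  else xget x0 [set y | exists k, y = rho k x].

Lemma orbit_repE x : exists k, x = rho k (orbit_rep x).
Proof.
rewrite /orbit_rep; case: asboolP => // _.
case: xgetP => [_ -> [k ->]|/(_ x) []]; last by exists 0.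
by exists (- k); rewrite iterzK.
Qed.

Lemma orbit_rep_iterz k x : orbit_rep (rho k x) = orbit_rep x.
Proof.
have shift y l : (exists j, rho l y = rho j x0) <-> (exists j, y = rho j x0).
  split=> -[j E].
    by exists (- l + j); rewrite iterzD // -E iterzK.
  by exists (l + j); rewrite iterzD // -E.
rewrite /orbit_rep; congr (if _ then _ else xget _ _).
  by apply: asbool_equiv_eq; exact: shift.
apply/seteqP; split=> y /= [j ->].
  by exists (j + k); rewrite iterzD.
by exists (j - k); rewrite -iterzD // subrK.
Qed.

Lemma orbit_rep_id x : orbit_rep (orbit_rep x) = orbit_rep x.
Proof. by have [k {2}->] := orbit_repE x; rewrite orbit_rep_iterz. Qed.

Lemma orbit_rep_base : orbit_rep x0 = x0.
Proof. by rewrite /orbit_rep; case: asboolP => // -[]; exists 0. Qed.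

Definition orbit_index := {r : T | orbit_rep r = r /\ r <> x0}.

Definition orbit_coord_index (x : T) : option orbit_index :=
  match pselect (orbit_rep x <> x0) with
  | left h => Some (exist _ (orbit_rep x) (conj (orbit_rep_id x) h))
  | right _ => None
  end.

Definition orbit_coord (x : T) : option orbit_index * int :=
  (orbit_coord_index x, projT1 (cid (orbit_repE x))).

Definition orbit_uncoord (y : option orbit_index * int) : T :=
  rho y.2 (oapp sval x0 y.1).

Lemma orbit_coordK : cancel orbit_coord orbit_uncoord.
Proof.
move=> x; rewrite /orbit_uncoord /=; case: cid => k /= E.
rewrite [RHS]E; congr iterz.
rewrite /orbit_coord_index; case: pselect => //= /contrapT -> //.
Qed.

(** The orbit of a point fixes its representative, and freeness then fixes the exponent. *)
Lemma orbit_uncoordK : cancel orbit_uncoord orbit_coord.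
Proof.
move=> [o k]; rewrite /orbit_coord.
have E : orbit_rep (orbit_uncoord (o, k)) = oapp sval x0 o.
  rewrite /orbit_uncoord orbit_rep_iterz /=.
  by case: o => [[r [rr rx]]|] //=; exact: orbit_rep_base.
congr pair.
  rewrite /orbit_coord_index; case: pselect.
    case: o E => [[r [rr rx]]|] /= E h; last by case: (h E).
    by congr Some; apply: eq_exist.
  case: o E => [[r [rr rx]]|] //= E []; first by rewrite E.
case: cid => l /= /esym; rewrite E /orbit_uncoord /= => El.
apply/eqP; rewrite -subr_eq0; apply/eqP/(free (x := rho k (oapp sval x0 o))).
by rewrite -iterzD // subrK.
Qed.

Lemma orbit_uncoord_iterz o k l :
  rho l (orbit_uncoord (o, k)) = orbit_uncoord (o, l + k).
Proof. by rewrite /orbit_uncoord iterzD. Qed.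

Lemma orbit_coord_f x : orbit_coord (f x) = ((orbit_coord x).1, (orbit_coord x).2 + 1).
Proof.
rewrite -{1}(orbit_coordK x); case: (orbit_coord x) => o k.
by rewrite [f _](orbit_uncoord_iterz o k 1) orbit_uncoordK addrC.
Qed.

End FreeOrbits.

(** The parameters swap in the recursive argument, so syllables of the two kinds alternate by typing
    and no reducedness condition has to be carried along. *)
Inductive stack (P Q : Type) : Type :=
| EmptyStack
| Push (s : stack Q P) (r : P).
Arguments EmptyStack {P Q}.

Fixpoint stack_cat L P Q (f : P -> seq L) (g : Q -> seq L) (s : stack P Q) :=
  if s is Push s r then f r ++ stack_cat g f s else [::].

Fixpoint stack_bottom X P Q (f : P -> X) (g : Q -> X) (d : X) (s : stack P Q) : X :=
  if s is Push s r then stack_bottom g f (f r) s else d.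

(** With [(o, k)] standing for $r w^k$, a product whose last factor lies in one group is rewritten
    with its last factor in the other: a nontrivial representative is pushed, otherwise $w^k$ is
    absorbed by the popped top, if there is one. The exponent never changes. *)
Definition exchange P Q (x : stack Q P * (option P * int)) :
    stack P Q * (option Q * int) :=
  match x with
  | (s, (Some r, k)) => (Push s r, (None, k))
  | (EmptyStack, (None, k)) => (EmptyStack, (None, k))
  | (Push s r, (None, k)) => (s, (Some r, k))
  end.

Lemma exchangeK P Q : cancel (@exchange P Q) (@exchange Q P).
Proof. by move=> [[|[|s r] r'] [[p|] k]]. Qed.

(** * The axis in the tree of B *)

Section AxisStates.
Variable n : nat.
Local Notation m := n.+2.
Local Notation M := (m.*2).
Local Notation letter := ('I_m * bool)%type.

Definition phase (i : int) : nat := `|(i %% M%:Z)%Z|%N.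

Lemma phaseE i : (phase i)%:Z = (i %% M%:Z)%Z.
Proof. by rewrite /phase gez0_abs // modz_ge0. Qed.

Lemma phase_lt i : (phase i < M)%N.
Proof. by rewrite -ltz_nat phaseE ltz_pmod. Qed.

Lemma phase_eqP i j : phase i = phase j -> exists k, i = j + k * M%:Z.
Proof.
move=> E; exists ((i %/ M%:Z)%Z - (j %/ M%:Z)%Z).
have := congr1 Posz E; rewrite !phaseE => E'.
move: (divz_eq i M%:Z) (divz_eq j M%:Z); rewrite E' mulrBl.
by move: (_ * _) (_ * _) => p q; lia.
Qed.

Lemma phaseDM i k : phase (i + k * M%:Z) = phase i.
Proof. by rewrite /phase addrC modzMDl. Qed.

Lemma phase_nat (j : nat) : (j < M)%N -> phase j%:Z = j.
Proof. by move=> lt; rewrite /phase modz_nat modn_small. Qed.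

Lemma phaseS i :
  phase (i + 1) = if (phase i).+1 == M then 0%N else (phase i).+1.
Proof.
apply/eqP; rewrite -eqz_nat phaseE; apply/eqP.
have := phase_lt i; have := phaseE i; move: (phase i) => p E lt.
rewrite {1}(divz_eq i M%:Z) -E -addrA modzMDl.
rewrite -PoszD addn1; case: eqP => [->|/eqP ne]; first by rewrite modzz.
by rewrite modz_nat modn_small // ltn_neqAle ne.
Qed.

(** The axis reads $c_1c_1c_2c_2\cdots c_mc_m$ periodically, whence the halved residue modulo
    $2m$. *)
Definition axis_letter (i : int) : 'I_m := inord (phase i)./2.

Lemma axis_letterDM i k : axis_letter (i + k * M%:Z) = axis_letter i.
Proof. by rewrite /axis_letter phaseDM. Qed.

Lemma axis_letter_inj i j :
  axis_letter i = axis_letter j -> (phase i)./2 = (phase j)./2.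
Proof.
move=> /(congr1 (@nat_of_ord _)); rewrite /axis_letter !inordK //.
  by have := phase_lt j; lia.
by have := phase_lt i; lia.
Qed.

(* The words of period c_1^2 ... c_m^2 overlap in at most one letter unless
   they agree, since m >= 2. *)
Lemma axis_overlap i j : phase i <> phase j ->
  axis_letter i = axis_letter j -> axis_letter (i + 1) <> axis_letter (j + 1).
Proof.
move=> ne /axis_letter_inj E /axis_letter_inj; rewrite !phaseS.
(* Distinct phases with equal halves are $2k$ and $2k+1$; the halves of their successors are $k$ and
   $k+1$ modulo $m$, which differ since $m\geq 2$. *)
have := phase_lt i; have := phase_lt j.
by case: eqP; case: eqP; lia.
Qed.

Definition on_axis (i : int) (x : letter) : bool :=
  (x == (axis_letter i, false)) || (x == (axis_letter (i - 1), true)).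

Definition inv_letter (x : letter) : letter := (x.1, ~~ x.2).

(* (i, v) stands for the reduced word leading from the origin along the axis to
   its vertex i and leaving the axis there through v, last letter first. *)
Definition axis_step0 (q : int * seq letter) (x : letter) : int * seq letter :=
  match q with
  | (i, [::]) => if x == (axis_letter i, false) then (i + 1, [::])
                 else if x == (axis_letter (i - 1), true) then (i - 1, [::])
                 else (i, [:: x])
  | (i, y :: v) => if y == inv_letter x then (i, v) else (i, x :: y :: v)
  end.

(** The last entry of the list is the letter leaving the axis, so it must not run along the axis.
    This makes the encoding of a vertex unique. *)
Fixpoint axis_reduced (i : int) (v : seq letter) : bool :=
  if v is y :: v' then
    (if v' is z :: _ then z != inv_letter y else ~~ on_axis i y)
    && axis_reduced i v'
  else true.

Definition axis_valid (q : int * seq letter) := axis_reduced q.1 q.2.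

Lemma inv_letterK : involutive inv_letter.
Proof. by move=> [x b]; rewrite /inv_letter /= negbK. Qed.

Lemma axis_step0_valid q x : axis_valid q -> axis_valid (axis_step0 q x).
Proof.
case: q => i [|y v]; rewrite /axis_valid /=.
  move=> _; case: ifP => // h1; case: ifP => // h2 /=.
  by rewrite /on_axis h1 h2.
by case: ifP => [_ /andP[]|h] //= ->; rewrite h.
Qed.

Lemma axis_step0K q x : axis_valid q ->
  axis_step0 (axis_step0 q x) (inv_letter x) = q.
Proof.
case: q => i [|y v]; rewrite /axis_valid /=.
  move=> _; case: ifP => [/eqP ->|h1] /=.
    by rewrite /inv_letter /= !xpair_eqE /= andbF addrK eqxx.
  case: ifP => [/eqP ->|h2] /=.
    by rewrite /inv_letter /= !xpair_eqE /= subrK eqxx.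
  by rewrite inv_letterK eqxx.
case: ifP => [/eqP -> |h] /=; last by rewrite inv_letterK eqxx.
case: v => [|z v] /=.
  by rewrite andbT /on_axis negb_or => /andP[/negbTE -> /negbTE ->].
by move=> /andP[/negbTE ->].
Qed.

(** The vertices of the Cayley tree of $B$, on which each letter acts bijectively by right
    multiplication. *)
Definition axis_state := {q : int * seq letter | axis_valid q}.

Definition axis_step (q : axis_state) (x : letter) : axis_state :=
  exist _ (axis_step0 (sval q) x) (axis_step0_valid x (svalP q)).

Lemma axis_stepK q x : axis_step (axis_step q x) (inv_letter x) = q.
Proof. by apply: val_inj; apply: axis_step0K (svalP q). Qed.

Definition axis_vertex (i : int) : axis_state := exist _ (i, [::]) isT.

Definition axis_pos (q : axis_state) : int := (sval q).1.

Lemma axis_step_vertex i :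
  axis_step (axis_vertex i) (axis_letter i, false) = axis_vertex (i + 1).
Proof. by apply: val_inj => /=; rewrite eqxx. Qed.

Lemma axis_pos_step q x : `|axis_pos (axis_step q x) - axis_pos q| <= 1.
Proof.
rewrite /axis_pos; case: q => [[i [|y v]] h] /=.
  by case: ifP => _; [|case: ifP => _] => /=; lia.
by case: ifP => _ /=; lia.
Qed.

Definition axis_word (i : int) (k : nat) : seq letter :=
  [seq (axis_letter (i + j%:Z), false) | j <- iota 0 k].

Definition axis_walk (i : int) (k : nat) (q : axis_state) : axis_state :=
  foldl axis_step q (axis_word i k).

Lemma axis_walkS i k q : axis_walk i k.+1 q =
  axis_step (axis_walk i k q) (axis_letter (i + k%:Z), false).
Proof.
by rewrite /axis_walk /axis_word -[k.+1]addn1 iotaD map_cat foldl_cat.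
Qed.

Lemma axis_walk_vertex i k :
  axis_walk i k (axis_vertex i) = axis_vertex (i + k%:Z).
Proof.
elim: k => [|k IH]; first by rewrite addr0.
by rewrite axis_walkS IH axis_step_vertex -addrA -PoszD addn1.
Qed.

Lemma axis_walk_inj i k : injective (axis_walk i k).
Proof.
elim: k => [//|k IH] q q'; rewrite !axis_walkS => E; apply: IH.
by rewrite -(axis_stepK (axis_walk i k q) (axis_letter (i + k%:Z), false)) E
  axis_stepK.
Qed.

Definition period_word : seq letter :=
  flatten [seq [:: (i, false); (i, false)] | i <- enum 'I_m].

Lemma period_wordE : period_word = axis_word 0 M.
Proof.
have E k : (k <= m)%N -> axis_word 0 k.*2 =
    flatten [seq [:: (inord i, false); (inord i, false)] | i <- iota 0 k].
  elim: k => [//|k IH] lt.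
  rewrite -[in iota 0 k.+1]addn1 iotaD map_cat flatten_cat /= -IH ?(ltnW lt) //.
  rewrite doubleS -[k.*2.+2]addn2 /axis_word iotaD map_cat /= !add0n; congr cat.
  rewrite /axis_letter !add0r !phase_nat ?uphalf_double ?doubleK //.
  + by rewrite -[k.*2.+1./2]/(uphalf k.*2) uphalf_double.
  + by rewrite ltn_Sdouble.
  + by rewrite ltn_double.
rewrite E // /period_word -val_enum_ord -map_comp; congr flatten.
by apply: eq_map => i /=; rewrite inord_val.
Qed.

Definition axis_shift (q : axis_state) : axis_state := axis_walk 0 M q.
Definition axis_unshift (q : axis_state) : axis_state :=
  foldl axis_step q (word_inv (axis_word 0 M)).

Lemma foldl_word_invK u q :
  foldl axis_step (foldl axis_step q u) (word_inv u) = q.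
Proof.
elim: u q => [//|x u IH] q.
rewrite -cat1s word_inv_cat foldl_cat /= IH.
by case: x => s b; exact: axis_stepK.
Qed.

Lemma axis_shiftK : cancel axis_shift axis_unshift.
Proof. by move=> q; apply: foldl_word_invK. Qed.

Lemma axis_unshiftK : cancel axis_unshift axis_shift.
Proof.
move=> q; rewrite /axis_shift /axis_walk -[axis_word 0 M]word_invK.
exact: foldl_word_invK.
Qed.

Lemma axis_walkDM i k q : axis_walk (k * M%:Z) i q = axis_walk 0 i q.
Proof.
rewrite /axis_walk; congr foldl; apply: eq_map => j.
by rewrite add0r addrC axis_letterDM.
Qed.

Lemma axis_shift_vertex k :
  axis_shift (axis_vertex (k * M%:Z)) = axis_vertex ((k + 1) * M%:Z).
Proof.
by rewrite /axis_shift -(axis_walkDM _ k) axis_walk_vertex mulrDl mul1r.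
Qed.

(* [axis_unshift] comes first because the relator identifies [a, b] with the
   inverse of the period. *)
Local Notation rho := (iterz axis_unshift axis_shift).

Lemma axis_rho_vertex k : rho k (axis_vertex 0) = axis_vertex (- k * M%:Z).
Proof.
elim/int_rect: k => [|k IH|k IH]; first by rewrite oppr0 mul0r.
  rewrite -addn1 PoszD (iterzS axis_shiftK) IH.
  rewrite (_ : - k%:Z = - (k%:Z + 1) + 1); last by rewrite opprD subrK.
  by rewrite -axis_shift_vertex axis_shiftK.
rewrite -addn1 PoszD opprD (iterzP axis_unshiftK axis_shiftK) IH.
by rewrite axis_shift_vertex opprB opprK addrC.
Qed.

(* Along the translate of the axis through a vertex outside the orbit of the
   origin, the nearest point on the axis can advance only once: the two lines
   then share that edge and, by axis_overlap, no other. *)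
Lemma axis_walk_lock q j : (forall k, q <> rho k (axis_vertex 0)) ->
  axis_pos (axis_walk 0 j q) = axis_pos q \/
  axis_pos (axis_walk 0 j q) = axis_pos q + 1.
Proof.
move=> out.
(* Meeting the axis in phase would, on undoing the [k] letters, put [q] itself in the orbit of the
   origin. *)
have off k i : axis_walk 0 k q = axis_vertex i -> phase i <> phase k%:Z.
  move=> E /phase_eqP[l ik]; apply: (out (- l)).
  rewrite axis_rho_vertex opprK; apply: (@axis_walk_inj 0 k).
  by rewrite E -(axis_walkDM _ l) axis_walk_vertex ik addrC.
(* Invariant after the single advance: either the branch ends in a positive letter, which the
   positive letter read next cannot cancel, or the walk is on the axis and the next letter read is
   not the next axis letter. Neither lets the position move again. *)
pose off_dir i (v : seq letter) (k : nat) : Prop :=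
  if v is y :: _ then ~~ y.2 else axis_letter k%:Z <> axis_letter i.
suff: axis_pos (axis_walk 0 j q) = axis_pos q \/
  (axis_pos (axis_walk 0 j q) = axis_pos q + 1 /\
   off_dir (axis_pos q + 1) (sval (axis_walk 0 j q)).2 j).
  by case=> [->|[-> _]]; [left|right].
elim: j => [|j]; first by left.
rewrite axis_walkS add0r; move: (off j); rewrite /axis_pos.
case: (axis_walk 0 j q) => [[i [|y v]] hv] /= offj.
- have {}offj : phase i <> phase j%:Z.
    by apply: offj; apply: val_inj.
  case=> [<-|[-> ne]].
    rewrite !xpair_eqE /= andbF andbT; case: eqP => [E|_]; last by left.
    right; split=> //=; rewrite -[j.+1]addn1 PoszD.
    by apply: axis_overlap E; apply: nesym.
  rewrite !xpair_eqE /= andbF andbT; case: eqP => // _.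
  by right.
- case=> [E|[E pos]]; first by left; case: ifP.
  right; case: ifP => [/eqP yE|_] //.
  by rewrite yE in pos.
Qed.

Lemma axis_rho_walk k q : rho (- k%:Z) q = iter k axis_shift q.
Proof.
by case: k.
Qed.

Lemma iter_axis_shift k q : iter k axis_shift q = axis_walk 0 (k * M) q.
Proof.
elim: k => [|k IH] //.
rewrite iterS IH /axis_shift -(axis_walkDM _ k%:Z) mulSn addnC.
rewrite /axis_walk -foldl_cat /axis_word iotaD map_cat; congr (foldl _ _ (_ ++ _)).
rewrite add0n -[in RHS](addn0 (k * M)%N) iotaDl -map_comp; apply: eq_map => j /=.
by rewrite add0r PoszD PoszM.
Qed.

(** A coset of $C$ in $B$ other than $C$ projects to the axis with diameter at most 1: of two of its
    points, one is reached from the other by reading whole periods forward, and [axis_walk_lock]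
    applies. *)
Lemma axis_pos_orbit q k l : (forall j, q <> rho j (axis_vertex 0)) ->
  `|axis_pos (rho k q) - axis_pos (rho l q)| <= 1.
Proof.
move=> out; wlog le_kl : k l / k <= l.
  move=> H; case: (leP k l) => [/H//|/ltW/H]; by rewrite distrC.
have [d ->] : exists d : nat, k = - d%:Z + l.
  by exists `|l - k|%N; lia.
rewrite (iterzD axis_unshiftK axis_shiftK) axis_rho_walk iter_axis_shift.
case: (@axis_walk_lock (rho l q) (d * M)) => [j E|->|->]; last by lia.
  apply: (out (- l + j)).
  by rewrite (iterzD axis_unshiftK axis_shiftK) -E
    (iterzK axis_unshiftK axis_shiftK).
by rewrite subrr normr0.
Qed.
End AxisStates.

(** * Powers of the commutator *)

Section GeneratedSubgroups.
Variables (G : groupType) (A : set G).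
Implicit Types x y : G.

Lemma generated_ind (K : set G) :
  is_subgroup K -> A `<=` K -> generated A `<=` K.
Proof. by move=> Ksub AK x; apply; split. Qed.

Lemma generated_mem : A `<=` generated A.
Proof. by move=> x Ax K [_ AK]; exact: AK. Qed.

Lemma generated_subgroup : is_subgroup (generated A).
Proof.
split=> [K [[K1 KM KV] _]|x y Ax Ay K KA|x Ax K KA] //.
  by have [[_ KM _] _] := KA; exact: (KM _ _ (Ax K KA) (Ay K KA)).
by have [[_ _ KV] _] := KA; exact: (KV _ (Ax K KA)).
Qed.

End GeneratedSubgroups.

Section IntegerPowers.
Variable G : groupType.
Implicit Types x y : G.

(** Makes the laws of integer powers instances of those of [iterz]. *)
Lemma iterz_mulg x k y :
  iterz (fun z => z * x)%g (fun z => z * x^-1)%g k y = (y * expgz x k)%g.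
Proof.
have E z j : iter j (fun t => t * z)%g y = (y * z ^+ j)%g.
  by elim: j => [|j IH] /=; rewrite ?mulg1 // IH expgSr mulgA.
by case: k => j; rewrite /iterz E //= expVgn.
Qed.

Lemma expgzD x k l : expgz x (k + l) = (expgz x k * expgz x l)%g.
Proof.
have fK : cancel (fun z => z * x)%g (fun z => z * x^-1)%g by move=> z; apply: mulgK.
have f'K : cancel (fun z => z * x^-1)%g (fun z => z * x)%g by move=> z; apply: mulgVK.
by rewrite -[LHS]mul1g -(iterz_mulg x _ 1%g) addrC (iterzD fK f'K) !iterz_mulg mul1g.
Qed.

Lemma expgzN x k : expgz x (- k) = (expgz x k)^-1%g.
Proof. by apply: (mulIg (expgz x k)); rewrite -expgzD addNr mulVg. Qed.

Lemma generated_expgz x k : generated [set x] (expgz x k).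
Proof.
have [_ CM CV] := generated_subgroup [set x].
have C1 := generated_mem (erefl : [set x] x).
have CX j : generated [set x] (x ^+ j)%g.
  elim: j => [|j IH]; first by have [] := generated_subgroup [set x].
  by rewrite expgSr; exact: (CM _ _ IH C1).
by case: k => j; [exact: CX|exact: (CV _ (CX j.+1))].
Qed.

Lemma generated1P x y : generated [set x] y -> exists k, y = expgz x k.
Proof.
apply: (@generated_ind _ _ [set z | exists k, z = expgz x k]); last first.
  by move=> _ ->; exists 1; rewrite /= expg1.
split=> [|_ _ [k ->] [l ->]|_ [k ->]].
- by exists 0.
- by exists (k + l); rewrite expgzD.
- by exists (- k); rewrite expgzN.
Qed.

End IntegerPowers.

(** * The surface group and the infinite order of $[a,b]$ *)

Section SurfaceGroup.
Variable n : nat.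
Local Notation m := n.+2.
Local Notation M := (m.*2).
Local Notation G := (surface_group m).
Local Notation letter := (surface_letter m * bool)%type.

Definition elt (u : seq letter) : G := (\pi_(presented [set @surface_relator m]) u)%qT.

Lemma elt_cat u v : elt (u ++ v) = (elt u * elt v)%g.
Proof. exact/esym/presented_mul_pi. Qed.

Lemma elt_inv u : elt (word_inv u) = (elt u)^-1%g.
Proof. exact/esym/presented_inv_pi. Qed.

Lemma elt_surj (x : G) : exists u, x = elt u.
Proof. by exists (repr x); rewrite /elt reprK. Qed.

Lemma elt_relator : elt (@surface_relator m) = 1%g.
Proof.
apply/presented_piP.
have := @word_eq_relator _ [set @surface_relator m] [::] [::] _ erefl.
by rewrite [_ ++ _ ++ _]cats0; apply: word_eq_sym.
Qed.

Definition gen_a : G := surface_a m.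
Definition gen_b : G := surface_b m.
Definition comm_ab : G := (gen_a * gen_b * gen_a^-1 * gen_b^-1)%g.

Definition emb (x : 'I_m * bool) : letter := (inr x.1, x.2).

Lemma map_emb_period : [seq emb x | x <- period_word n] =
  flatten [seq [:: (letter_c i, false); (letter_c i, false)] | i <- enum 'I_m].
Proof. by rewrite /period_word map_flatten; congr flatten; rewrite -map_comp. Qed.

Lemma elt_period : elt [seq emb x | x <- period_word n] = comm_ab^-1%g.
Proof.
have := elt_relator; rewrite elt_cat.
set u := elt _; set v := elt _ => E.
have -> : comm_ab = u.
  rewrite /u -[X in elt X]/([:: (letter_a m, false)] ++ [:: (letter_b m, false)]
    ++ word_inv [:: (letter_a m, false)] ++ word_inv [:: (letter_b m, false)]).
  by rewrite !elt_cat !elt_inv !mulgA.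
by rewrite map_emb_period; apply: (mulgI u); rewrite E mulgV.
Qed.

Section Heisenberg.

(* The integral Heisenberg group with its centre doubled, so that c_1 can be
   sent to a square root of the inverse of [a, b]; only the coordinates which
   matter for the centre are recorded. *)
Definition heis_act (t : int * int) (x : letter) : int * int :=
  let e := if x.2 then -1 else 1 in
  match x.1 with
  | inl false => (t.1 + e, t.2)
  | inl true => (t.1, t.2 + e * 2 * t.1)
  | inr i => (t.1, t.2 - e * (i == ord0)%:Z)
  end.

Lemma heis_actK t s b : heis_act (heis_act t (s, b)) (s, ~~ b) = t.
Proof.
by case: t => x z; case: s => [[|]|i]; case: b; rewrite /heis_act /=;
  congr pair; lia.
Qed.

Lemma heis_act_period t (s : seq 'I_m) :
  foldl heis_act t
    (flatten [seq [:: (letter_c i, false); (letter_c i, false)] | i <- s])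
  = (t.1, t.2 - (2 * count_mem ord0 s)%:Z).
Proof.
elim: s t => [|i s IH] [x z]; first by rewrite /= muln0 subr0.
rewrite /= IH /heis_act /=; congr pair; case: eqP => _ /=; lia.
Qed.

(** The commutator adds 2 to the second coordinate; [ord0] occurs once in the enumeration, and its
    square subtracts 2. *)
Lemma heis_act_rel r t : [set @surface_relator m] r -> foldl heis_act t r = t.
Proof.
move=> ->; rewrite foldl_cat heis_act_period count_uniq_mem ?enum_uniq //.
by rewrite mem_enum inE; case: t => x z; rewrite /heis_act /=; congr pair; lia.
Qed.

(** Each factor $w$ raises the central coordinate by 2. The freeness statements [rhoP_free] and
    [rhoQ_free] rest on this. *)
Lemma expgz_comm_ab_inj k : expgz comm_ab k = 1%g -> k = 0.
Proof.
pose act := presented_act heis_act (rels := [set @surface_relator m]).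
have actM t x y : act t (x * y)%g = act (act t x) y.
  exact: (presented_actM heis_actK heis_act_rel).
have act1 t : act t 1%g = t by exact: (presented_act1 heis_actK heis_act_rel).
have actV t x : act (act t x) x^-1%g = t by rewrite -actM mulgV act1.
have actg t s : act t (presented_gen _ s) = heis_act t (s, false).
  exact: (presented_act_pi heis_actK heis_act_rel).
have actgV t s : act t (presented_gen _ s)^-1%g = heis_act t (s, true).
  by rewrite -{1}(heis_actK t s true) -actg actV.
have actw t : act t comm_ab = (t.1, t.2 + 2).
  rewrite !actM !actg !actgV /heis_act /=; congr pair; lia.
have actwk l : act (0, 0) (expgz comm_ab l) = (0, 2 * l).
  elim/int_rect: l => [|l IH|l IH]; first exact: act1.
    by rewrite (intS l) addrC expgzD actM IH /= expg1 actw /=; congr pair; lia.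
  rewrite (intS l) opprD addrC expgzD actM IH expgzN /= expg1.
  rewrite -[RHS](actV _ comm_ab) actw /=; congr (act (_, _) _); lia.
by move=> E; have := actwk k; rewrite E act1 => -[]; lia.
Qed.

End Heisenberg.
End SurfaceGroup.

(** * Normal forms *)

Section NormalForms.
Variable n : nat.
Local Notation m := n.+2.
Local Notation M := (m.*2).
Local Notation G := (surface_group m).
Local Notation letter := (surface_letter m * bool)%type.
Local Notation w := (comm_ab n).

Definition subgroup_ab : set G := generated [set gen_a n; gen_b n].
Local Notation H := subgroup_ab.

Lemma subgroup_ab_subgroup : is_subgroup H.
Proof. exact: generated_subgroup. Qed.

Lemma subgroup_ab1 : H 1%g. Proof. by case: subgroup_ab_subgroup. Qed.
Lemma subgroup_abM x y : H x -> H y -> H (x * y)%g.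
Proof. by case: subgroup_ab_subgroup => _ + _; apply. Qed.
Lemma subgroup_abV x : H x -> H x^-1%g.
Proof. by case: subgroup_ab_subgroup => _ _; apply. Qed.
Lemma subgroup_ab_a : H (gen_a n). Proof. by apply: generated_mem; left. Qed.
Lemma subgroup_ab_b : H (gen_b n). Proof. by apply: generated_mem; right. Qed.

Lemma subgroup_ab_comm : H w.
Proof.
do !apply: subgroup_abM; try apply: subgroup_abV;
  first [exact: subgroup_ab_a|exact: subgroup_ab_b].
Qed.

Definition hmk x (hx : H x) : H := exist _ x (mem_set hx).
Definition hval (p : H) : G := val p.

Lemma hval_inj : injective hval. Proof. exact: val_inj. Qed.
Lemma hvalP (p : H) : H (hval p). Proof. exact: set_mem (valP p). Qed.

Definition hone : H := hmk subgroup_ab1.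
Definition hmul (p q : H) : H := hmk (subgroup_abM (hvalP p) (hvalP q)).
Definition hinv (p : H) : H := hmk (subgroup_abV (hvalP p)).
Definition hcomm : H := hmk subgroup_ab_comm.

Lemma hvalM p q : hval (hmul p q) = (hval p * hval q)%g. Proof. by []. Qed.
Lemma hvalV p : hval (hinv p) = (hval p)^-1%g. Proof. by []. Qed.

Definition pshift (p : H) : H := hmul p hcomm.
Definition punshift (p : H) : H := hmul p (hinv hcomm).

Lemma hmulK p q : hmul (hmul p q) (hinv q) = p.
Proof. by apply: hval_inj; apply: mulgK. Qed.

Lemma hmulVK p q : hmul (hmul p (hinv q)) q = p.
Proof. by apply: hval_inj; apply: mulgVK. Qed.

Lemma pshiftK : cancel pshift punshift.
Proof. by move=> p; apply: hmulK. Qed.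

Lemma punshiftK : cancel punshift pshift.
Proof. by move=> p; apply: hmulVK. Qed.

Local Notation rhoP := (iterz pshift punshift).

Lemma hval_rho k p : hval (rhoP k p) = (hval p * expgz w k)%g.
Proof.
rewrite -iterz_mulg; case: k => j; rewrite /iterz.
  by elim: j => [|j IH] //; rewrite !iterS -IH.
by elim: j.+1 => [|i IH] //; rewrite !iterS -IH.
Qed.

Lemma rhoP_free k p : rhoP k p = p -> k = 0.
Proof.
move=> E; apply: (@expgz_comm_ab_inj n); apply: (@mulgI _ (hval p)).
by rewrite -hval_rho E mulg1.
Qed.

(** The value in [G] of vertex [i] of the axis. As [Negz j] is $-(j+1)$, the edges crossed backwards
    from the origin are those starting at [Negz 0], [Negz 1] and so on. *)
Definition axis_elt (i : int) : G :=
  match i with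
  | Posz k => foldl (fun g j => g * surface_c (axis_letter n (Posz j)))%g 1%g (iota 0 k)
  | Negz k => foldl (fun g j => g * (surface_c (axis_letter n (Negz j)))^-1)%g 1%g
                (iota 0 k.+1)
  end.

Lemma iotaSr (k : nat) : iota 0 k.+1 = iota 0 k ++ [:: k].
Proof. by rewrite -[k.+1]addn1 iotaD. Qed.

Lemma axis_eltS i : axis_elt (i + 1) = (axis_elt i * surface_c (axis_letter n i))%g.
Proof.
case: i => k; first by rewrite addrC -intS /axis_elt iotaSr foldl_cat.
have -> : Negz k + 1 = - k%:Z by rewrite NegzE; lia.
rewrite [axis_elt (Negz k)]/axis_elt iotaSr foldl_cat /= mulgVK.
by case: k.
Qed.

Definition letter_elt (x : 'I_m * bool) : G := elt [:: emb x].

Lemma letter_eltV x : letter_elt (inv_letter x) = (letter_elt x)^-1%g.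
Proof. exact: (elt_inv [:: emb x]). Qed.

Definition qval (q : axis_state n) : G :=
  foldr (fun x g => g * letter_elt x)%g (axis_elt (sval q).1) (sval q).2.

Lemma qval_step q x : qval (axis_step q x) = (qval q * letter_elt x)%g.
Proof.
case: q => [[i [|y v]] hv]; rewrite /qval /=.
  case: ifP => [/eqP ->|_] /=; first exact: axis_eltS.
  case: ifP => [/eqP ->|_] //=.
  rewrite -{2}(subrK 1 i) axis_eltS.
  by rewrite -[(_, true)]/(inv_letter (_, false)) letter_eltV mulgK.
case: ifP => [/eqP ->|_] //=.
by rewrite letter_eltV mulgVK.
Qed.

Lemma qval_foldl u q :
  qval (foldl (@axis_step n) q u) = (qval q * elt [seq emb x | x <- u])%g.
Proof.
elim: u q => [|x u IH] q; first by rewrite /= mulg1.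
by rewrite /= IH qval_step -mulgA -elt_cat.
Qed.

Lemma qval_shift q : qval (axis_shift q) = (qval q * w^-1)%g.
Proof. by rewrite /axis_shift /axis_walk -period_wordE qval_foldl elt_period. Qed.

Lemma qval_unshift q : qval (axis_unshift q) = (qval q * w)%g.
Proof. by rewrite -{2}(axis_unshiftK q) qval_shift mulgVK. Qed.

Local Notation rhoQ := (iterz (@axis_unshift n) (@axis_shift n)).

Lemma qval_rho k q : qval (rhoQ k q) = (qval q * expgz w k)%g.
Proof.
rewrite -iterz_mulg; case: k => j; rewrite /iterz.
  by elim: j => [|j IH] //; rewrite !iterS -IH qval_unshift.
by elim: j.+1 => [|i IH] //; rewrite !iterS -IH qval_shift.
Qed.

Lemma rhoQ_free k q : rhoQ k q = q -> k = 0.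
Proof.
move=> E; apply: (@expgz_comm_ab_inj n); apply: (@mulgI _ (qval q)).
by rewrite -qval_rho E mulg1.
Qed.

Definition qone : axis_state n := axis_vertex n 0.

Lemma qval1 : qval qone = 1%g. Proof. by []. Qed.

Local Notation Q := (axis_state n).
Local Notation P' := (orbit_index pshift punshift hone).
Local Notation Q' := (orbit_index (@axis_unshift n) (@axis_shift n) qone).

(** The orbits of [pshift] are the left cosets of $C$ in $H$, so the coordinates of an element
    express it as $r w^k$. *)
Definition p_coord : H -> option P' * int := orbit_coord hone pshiftK punshiftK.
Definition p_uncoord : option P' * int -> H := @orbit_uncoord _ _ _ _.
Definition q_coord : Q -> option Q' * int :=
  orbit_coord qone (@axis_unshiftK n) (@axis_shiftK n).
Definition q_uncoord : option Q' * int -> Q := @orbit_uncoord _ _ _ _.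

Arguments p_coord : simpl never.
Arguments p_uncoord : simpl never.
Arguments q_coord : simpl never.
Arguments q_uncoord : simpl never.

Lemma p_coordK : cancel p_coord p_uncoord. Proof. exact: orbit_coordK. Qed.
Lemma q_coordK : cancel q_coord q_uncoord. Proof. exact: orbit_coordK. Qed.
Lemma p_uncoordK : cancel p_uncoord p_coord.
Proof. exact/orbit_uncoordK/rhoP_free. Qed.
Lemma q_uncoordK : cancel q_uncoord q_coord.
Proof. exact/orbit_uncoordK/rhoQ_free. Qed.

(* An element is written as a product of alternating nontrivial representatives
   of cosets of <w>, stored last factor first, followed by an element of B
   ([state]) or of H ([hstate]). *)
Definition state := (stack P' Q' * Q)%type.
Definition hstate := (stack Q' P' * H)%type.

Definition to_h (x : state) : hstate :=
  let y := exchange (x.1, q_coord x.2) in (y.1, p_uncoord y.2).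
Definition of_h (x : hstate) : state :=
  let y := exchange (x.1, p_coord x.2) in (y.1, q_uncoord y.2).

Lemma to_hK : cancel to_h of_h.
Proof.
move=> [s q]; rewrite /of_h /to_h; cbn [fst snd].
rewrite p_uncoordK -surjective_pairing exchangeK; cbn [fst snd].
by rewrite q_coordK.
Qed.

Lemma of_hK : cancel of_h to_h.
Proof.
move=> [s p]; rewrite /to_h /of_h; cbn [fst snd].
rewrite q_uncoordK -surjective_pairing exchangeK; cbn [fst snd].
by rewrite p_coordK.
Qed.

(** $H$ multiplies the last factor of an [hstate]; transport along [to_h] makes it act on the same
    set as $B$. *)
Definition act_h (x : state) (h : H) : state :=
  let y := to_h x in of_h (y.1, hmul y.2 h).

Lemma act_hM x h h' : act_h (act_h x h) h' = act_h x (hmul h h').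
Proof.
rewrite /act_h of_hK /=; congr (of_h (_, _)).
by apply: hval_inj; rewrite !hvalM mulgA.
Qed.

Lemma act_h1 x h : hval h = 1%g -> act_h x h = x.
Proof.
move=> E; rewrite /act_h (_ : hmul _ h = (to_h x).2).
  by rewrite -surjective_pairing to_hK.
by apply: hval_inj; rewrite hvalM E mulg1.
Qed.

Definition h_letter (e : bool) : H :=
  if e then hmk subgroup_ab_b else hmk subgroup_ab_a.

Definition act (x : state) (l : letter) : state :=
  match l.1 with
  | inl e => act_h x (if l.2 then hinv (h_letter e) else h_letter e)
  | inr i => (x.1, axis_step x.2 (i, l.2))
  end.

Lemma act_letterK x s b : act (act x (s, b)) (s, ~~ b) = x.
Proof.
case: s => [e|i]; rewrite /act /=; last first.
  by rewrite -[(i, ~~ b)]/(inv_letter (i, b)) axis_stepK -surjective_pairing.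
by rewrite act_hM act_h1 //; case: b => /=; [exact: mulVg|exact: mulgV].
Qed.

Lemma foldl_act_emb s q u :
  foldl act (s, q) [seq emb x | x <- u] = (s, foldl (@axis_step n) q u).
Proof. by elim: u q => [//|[i b] u IH] q; rewrite /= IH. Qed.

Lemma p_coord_shift p : p_coord (pshift p) = ((p_coord p).1, (p_coord p).2 + 1).
Proof. exact/orbit_coord_f/rhoP_free. Qed.

Lemma q_uncoord_shift o k : q_uncoord (o, k + 1) = axis_unshift (q_uncoord (o, k)).
Proof. exact: (iterzS (@axis_shiftK n)). Qed.

Lemma of_h_shift s p :
  of_h (s, pshift p) = ((of_h (s, p)).1, axis_unshift (of_h (s, p)).2).
Proof.
rewrite /of_h; cbn [fst snd]; rewrite p_coord_shift.
case: (p_coord p) => o k; cbn [fst snd].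
by case: o s => [r|] [|s r'] /=; rewrite q_uncoord_shift.
Qed.

(** The amalgamation condition: $w$ acts in the same way through $H$ and through $B$, because
    [exchange] preserves the exponent of $w$. *)
Lemma act_h_comm x : act_h x hcomm = (x.1, axis_unshift x.2).
Proof.
by rewrite /act_h -[hmul _ _]/(pshift _) of_h_shift -surjective_pairing to_hK.
Qed.

Lemma act_relator r x : [set @surface_relator m] r -> foldl act x r = x.
Proof.
move=> ->; rewrite foldl_cat.
have -> : foldl act x [:: (letter_a m, false); (letter_b m, false);
    (letter_a m, true); (letter_b m, true)] = act_h x hcomm.
  rewrite /= /act /= !act_hM; congr act_h.
  by apply: hval_inj; rewrite !hvalM !mulgA.
rewrite act_h_comm.
rewrite -map_emb_period foldl_act_emb period_wordE -/(axis_walk _ _ _) -/(axis_shift _).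
by rewrite axis_unshiftK -surjective_pairing.
Qed.

Definition state_act (x : state) (g : G) : state :=
  presented_act act (rels := [set @surface_relator m]) x g.

Lemma state_act1 x : state_act x 1%g = x.
Proof. exact: (presented_act1 act_letterK act_relator). Qed.

Lemma state_actM x g h : state_act x (g * h)%g = state_act (state_act x g) h.
Proof. exact: (presented_actM act_letterK act_relator). Qed.

Lemma state_actE x u : state_act x (elt u) = foldl act x u.
Proof. exact: (presented_act_pi act_letterK act_relator). Qed.

Lemma state_act_h x (h : H) : state_act x (hval h) = act_h x h.
Proof.
(* Phrased as membership in a subgroup of [G], with [h] quantified inside, the claim need only be
   checked on $a$ and $b$. *)
suff [_] : [set g | H g /\ forall h x, hval h = g -> state_act x g = act_h x h]
  (hval h) by apply.
apply: generated_ind (hvalP h).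
  split=> [|g g' [Hg Eg] [Hg' Eg']|g [Hg Eg]].
  - split; first exact: subgroup_ab1.
    by move=> h' x' E; rewrite state_act1 act_h1.
  - split=> [|h' x' E]; first exact: subgroup_abM.
    rewrite state_actM (Eg (hmk Hg)) // (Eg' (hmk Hg')) // act_hM.
    by congr act_h; apply: hval_inj; rewrite E.
  - split=> [|h' x' E]; first exact: subgroup_abV.
    have {1}-> : x' = act_h (act_h x' h') (hmk Hg).
      by rewrite act_hM act_h1 // hvalM E mulVg.
    by rewrite -(Eg (hmk Hg)) // -state_actM mulgV state_act1.
have gen e : forall h x, hval h = hval (h_letter e) ->
    state_act x (hval (h_letter e)) = act_h x h.
  move=> h' x' /hval_inj ->.
  have -> : hval (h_letter e) = elt [:: (inl e, false)] by case: e.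
  by rewrite state_actE.
by move=> g [->|->]; split; [exact: subgroup_ab_a|exact: (gen false)|
  exact: subgroup_ab_b|exact: (gen true)].
Qed.

Fixpoint stack_val S T (f : S -> G) (g : T -> G) (s : stack S T) : G :=
  if s is Push s r then (stack_val g f s * f r)%g else 1%g.

Definition p_val (r : P') : G := hval (sval r).
Definition q_val (r : Q') : G := qval (sval r).
Definition state_val (x : state) : G :=
  (stack_val p_val q_val x.1 * qval x.2)%g.
Definition hstate_val (x : hstate) : G :=
  (stack_val q_val p_val x.1 * hval x.2)%g.

Lemma hval_uncoord o k :
  hval (p_uncoord (o, k)) = (oapp p_val 1 o * expgz w k)%g.
Proof. by rewrite /p_uncoord /orbit_uncoord hval_rho; case: o. Qed.

Lemma qval_uncoord o k :
  qval (q_uncoord (o, k)) = (oapp q_val 1 o * expgz w k)%g.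
Proof. by rewrite /q_uncoord /orbit_uncoord qval_rho; case: o. Qed.

(** Inside the product, [exchange] merely splits or reassembles a factor $r w^k$. *)
Lemma state_val_of_h x : state_val (of_h x) = hstate_val x.
Proof.
case: x => s p; rewrite -(p_coordK p); case: (p_coord p) => o k.
rewrite /of_h; cbn [fst snd]; rewrite p_uncoordK /hstate_val /state_val.
cbn [fst snd]; rewrite hval_uncoord.
by case: o s => [r|] [|s r'] /=; rewrite qval_uncoord /= ?mul1g ?mulgA.
Qed.

Lemma hstate_val_to_h x : hstate_val (to_h x) = state_val x.
Proof. by rewrite -state_val_of_h to_hK. Qed.

Lemma state_val_act_h x h : state_val (act_h x h) = (state_val x * hval h)%g.
Proof. by rewrite state_val_of_h -(hstate_val_to_h x) /hstate_val /= mulgA. Qed.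

Lemma state_val_act x l : state_val (act x l) = (state_val x * elt [:: l])%g.
Proof.
case: l => [[e|i] b]; rewrite /act /=; last first.
  by rewrite /state_val /= qval_step mulgA.
rewrite state_val_act_h; congr (_ * _)%g.
by case: e; case: b => //; exact/esym/(elt_inv [:: (_, false)]).
Qed.

Lemma state_val_state_act x g : state_val (state_act x g) = (state_val x * g)%g.
Proof.
have [u ->] := elt_surj g; rewrite state_actE.
elim: u x => [|l u IH] x; first by rewrite mulg1.
by rewrite /= IH state_val_act -(cat1s l u) elt_cat mulgA.
Qed.

Definition origin : state := (EmptyStack, qone).
Definition normal_form (g : G) : state := state_act origin g.

Lemma normal_form_val g : state_val (normal_form g) = g.
Proof. by rewrite state_val_state_act /state_val /= !mul1g. Qed.

Lemma to_h_origin : to_h origin = (EmptyStack, hone).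
Proof.
rewrite -[RHS]of_hK; congr to_h; rewrite /of_h; cbn [fst snd].
rewrite (_ : p_coord hone = (None, 0)) //.
exact: (p_uncoordK (None, 0)).
Qed.

End NormalForms.

(** * The relative metric *)

Section Walks.
Variables (V E : Type) (src tgt : E -> V).
Local Notation walk := (walk src tgt).

Lemma walk_cat A u v x p q :
  walk A u p v -> walk A v q x -> walk A u (p ++ q) x.
Proof.
elim: p u => [|s p IH] u /=; first by move=> ->.
by case=> As su pv qx; split=> //; exact: IH.
Qed.

Lemma walk_sub (A B : set E) u v p : A `<=` B -> walk A u p v -> walk B u p v.
Proof.
move=> AB; elim: p u => [//|s p IH] u [/AB Bs su pv]; split=> //; exact: IH.
Qed.

Definition rev_step (s : step E) : step E := (s.1, ~~ s.2).

Lemma walk_rev A u v p :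
  walk A u p v -> walk A v (rev [seq rev_step s | s <- p]) u.
Proof.
elim: p u => [|s p IH] u /=; first by move=> ->.
case=> As su pv; rewrite rev_cons -cats1; apply: walk_cat (IH _ pv) _.
by split=> //; rewrite -?su; case: s {As su pv} => e [].
Qed.

Variable R : realType.
Local Notation dist A u v := (walk_dist R src tgt A u v).

Lemma walk_dist_le A u v p : walk A u p v -> (dist A u v <= (size p)%:R%:E)%E.
Proof. by move=> pw; apply: ereal_inf_lbound; exists p. Qed.

Lemma walk_dist_ge A u v x :
  (forall p, walk A u p v -> (x <= (size p)%:R%:E)%E) -> (x <= dist A u v)%E.
Proof. by move=> px; apply: le_ereal_inf_tmp => _ [p pw <-]; apply: px. Qed.

Lemma walk_dist_oo A u v : (forall p, ~ walk A u p v) -> dist A u v = +oo%E.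
Proof.
move=> no; rewrite /walk_dist (_ : [set p | _] = set0) ?image_set0 ?ereal_inf0 //.
by apply/seteqP; split=> p // /no.
Qed.

End Walks.

(** * Cayley graphs and left translations *)

Section CayleyWalks.
Variables (G : groupType) (X H : set G).
Local Notation src := (@cayley_src G X H).
Local Notation tgt := (@cayley_tgt G X H).
Local Notation walk := (walk src tgt).

Definition step_val (s : step (cayley_edge X H)) : G :=
  if s.2 then (label_val s.1.2)^-1%g else label_val s.1.2.

Lemma step_stopE s :
  step_stop src tgt s = (step_start src tgt s * step_val s)%g.
Proof.
case: s => [[g l] []] //; rewrite /step_stop /step_start /step_val /=.
by rewrite /cayley_tgt /= mulgK.
Qed.

Definition translate_step (g : G) (s : step (cayley_edge X H)) :=
  (((g * s.1.1)%g, s.1.2), s.2).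

Lemma walk_translate (A : set (cayley_edge X H)) g u v p :
  (forall x l, A (x, l) -> A ((g * x)%g, l)) ->
  walk A u p v -> walk A (g * u)%g (map (translate_step g) p) (g * v)%g.
Proof.
move=> Ag; elim: p u => [|[[x l] b] p IH] u /=; first by move=> ->.
move=> [/Ag As <- pv]; split=> //.
  by case: b {pv}; rewrite /step_start /= /cayley_tgt /= ?mulgA.
have {}IH := IH _ pv.
by case: b IH {pv}; rewrite /step_stop /= /cayley_tgt /= ?mulgA.
Qed.

Lemma walk_dist_translate (R : realType) (A : set (cayley_edge X H)) g u v :
  (forall x l, A (x, l) <-> A ((g * x)%g, l)) ->
  walk_dist R src tgt A (g * u)%g (g * v)%g = walk_dist R src tgt A u v.
Proof.
move=> Ag; apply/le_anti/andP; split; apply: walk_dist_ge => p pw.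
  rewrite -(size_map (translate_step g)); apply: walk_dist_le.
  by apply: walk_translate pw => x l /Ag.
rewrite -(size_map (translate_step g^-1%g)); apply: walk_dist_le.
rewrite -(mulKg g u) -(mulKg g v); apply: walk_translate pw => x l Ax.
by apply/Ag; rewrite mulVKg.
Qed.

(** Left multiplication by an element of [H] is an automorphism of the Cayley graph preserving
    $\Gamma(H,H)$. *)
Lemma relative_dist_translate (R : realType) g u v : is_subgroup H -> H g ->
  relative_dist R X H (g * u)%g (g * v)%g = relative_dist R X H u v.
Proof.
move=> [H1 HM HV] Hg; apply: walk_dist_translate => x l.
have HgE y : H (g * y)%g <-> H y.
  split=> [Hgy|]; last exact: HM.
  by rewrite -(mulKg g y); apply: HM Hgy; apply: HV.
apply: not_iff_compat; rewrite /subgroup_edge /= /cayley_tgt /cayley_src /=.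
by split=> -[lh Hx Hxl]; split=> //; move: Hx Hxl; rewrite -?mulgA => /HgE ? /HgE.
Qed.

End CayleyWalks.

(** * Admissible paths in the surface group *)

Section RelativeMetric.
Variable n : nat.
Local Notation m := n.+2.
Local Notation M := (m.*2).
Local Notation G := (surface_group m).
Local Notation w := (comm_ab n).
Local Notation H := (@subgroup_ab n).
Local Notation X := (range (@surface_c m)).
Local Notation src := (@cayley_src G X H).
Local Notation tgt := (@cayley_tgt G X H).
Local Notation walk := (walk src tgt).
Local Notation adm := (~` @subgroup_edge G X H).

Definition c_label (i : 'I_m) : X :=
  exist (fun x => x \in X) (surface_c i) (mem_set (imageT (@surface_c m) i)).

Definition c_step (g : G) (x : 'I_m * bool) : step (cayley_edge X H) :=
  if x.2 then (((g * (surface_c x.1)^-1)%g, inl (c_label x.1)), true)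
  else ((g, inl (c_label x.1)), false).

Lemma c_walk g (u : seq ('I_m * bool)) : exists p,
  size p = size u /\ walk adm g p (g * elt [seq emb x | x <- u])%g.
Proof.
elim: u g => [|x u IH] g; first by exists [::]; rewrite /= mulg1.
have [p [sp pw]] := IH (g * elt [:: emb x])%g.
exists (c_step g x :: p); split; first by rewrite /= sp.
rewrite -[map _ (x :: u)]/([:: emb x] ++ map (@emb n) u) elt_cat mulgA.
case: x pw => i b pw; split.
- by case: b {pw} => -[[]].
- by case: b {pw}; rewrite /c_step /step_start /= /cayley_tgt /= ?mulgVK.
- case: b pw => // pw; rewrite /c_step /step_stop /= /cayley_src /=.
  by rewrite -(elt_inv [:: (letter_c i, false)]).
Qed.

Lemma size_period_word : size (period_word n) = M.
Proof. by rewrite period_wordE size_map size_iota. Qed.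

(** The period word, of length $2m$, represents $w^{-1}$, so $w^k$ is spelled by $|k|$ copies of it
    or of its inverse. *)
Lemma comm_walk (k : int) g : exists p,
  size p = (M * `|k|)%N /\ walk adm g p (g * expgz w k)%g.
Proof.
have word_pow (u : seq ('I_m * bool)) j : exists v, size v = (size u * j)%N /\
    elt [seq emb x | x <- v] = (elt [seq emb x | x <- u] ^+ j)%g.
  elim: j => [|j [v [sv ev]]]; first by exists [::]; rewrite muln0.
  exists (v ++ u); rewrite size_cat sv mulnS addnC map_cat elt_cat ev.
  by rewrite -expgSr.
suff [v [sv ev]] : exists v, size v = (M * `|k|)%N /\
    elt [seq emb x | x <- v] = expgz w k.
  by have := c_walk g v; rewrite sv ev.
case: k => j; last first.
  have [v] := word_pow (period_word n) j.+1.
  by rewrite size_period_word elt_period expVgn; exists v.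
have [v] := word_pow (word_inv (period_word n)) j.
rewrite /word_inv size_rev size_map size_period_word map_rev -map_comp.
have -> : rev [seq emb (x.1, ~~ x.2) | x <- period_word n]
   = word_inv [seq emb x | x <- period_word n].
  by rewrite /word_inv -map_comp.
by rewrite elt_inv elt_period invgK; exists v.
Qed.

Local Notation P' := (orbit_index (@pshift n) (@punshift n) (@hone n)).
Local Notation Q' := (orbit_index (@axis_unshift n) (@axis_shift n) (qone n)).

(* The position of the nearest point on the axis of <w> in the tree of B; [None]
   marks the elements whose first syllable lies in H, none of which an admissible
   path from 1 can reach. *)
Definition potential (x : state n) : option int :=
  stack_bottom (fun _ : P' => None) (fun r : Q' => Some (axis_pos (sval r)))
    (Some (axis_pos x.2)) x.1.

(** Besides the bound, this says that a potential once defined stays defined. *)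
Definition moves_by (x x' : state n) (d : nat) : Prop :=
  forall z, potential x = Some z ->
    exists2 z', potential x' = Some z' & `|z' - z| <= d%:Z.

Lemma moves_by_c x i b : moves_by x (act x (inr i, b)) 1.
Proof.
case: x => [[|s r] q] z /=; rewrite /act /potential /=; last first.
  by move=> ->; exists z; rewrite // subrr.
by move=> [<-]; eexists; [reflexivity|exact: axis_pos_step].
Qed.

(** The syllable [r] either stays on the stack or is popped and becomes $r w^k$; this matters only
    if it is the bottom one. *)
Lemma potential_of_h s r p : exists k, potential (of_h (Push s r, p)) =
  stack_bottom (fun _ : P' => None) (fun r : Q' => Some (axis_pos (sval r)))
    (Some (axis_pos (iterz (@axis_unshift n) (@axis_shift n) k (sval r)))) s.
Proof.
rewrite /of_h; cbn [fst snd]; case: (p_coord p) => [[r'|] k] /=.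
  by exists 0.
by exists k.
Qed.

Lemma index_off_orbit (r : Q') j :
  sval r <> iterz (@axis_unshift n) (@axis_shift n) j (qone n).
Proof.
case: r => r [/= rr rne] E; apply: rne.
by rewrite -rr E orbit_rep_iterz ?orbit_rep_base //;
  [exact: axis_unshiftK|exact: axis_shiftK].
Qed.

(** Only a lone syllable $r$ in $B$ can be affected, and its replacements stay in the coset $rC\neq
    C$, where [axis_pos_orbit] applies. *)
Lemma moves_by_h x h : (to_h x).1 <> EmptyStack -> moves_by x (act_h x h) 1.
Proof.
rewrite -{2 3}(to_hK x) /act_h of_hK; case: (to_h x) => [[|s r] p] //= _ z.
have [k ->] := potential_of_h s r p.
have [l ->] := potential_of_h s r (hmul p h).
case: s => [|s r'] /=; last by move=> ->; exists z; rewrite // subrr.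
by move=> [<-]; eexists; [reflexivity|exact: (axis_pos_orbit l k (@index_off_orbit r))].
Qed.

Lemma normal_formM (g h : G) : normal_form (g * h)%g = state_act (normal_form g) h.
Proof. exact: state_actM. Qed.

Lemma step_valP (s : step (cayley_edge X H)) :
  match s.1.2 with
  | inl _ => exists i b, step_val s = elt [:: (inr i, b)]
  | inr _ => exists h : H, step_val s = hval h
  end.
Proof.
case: s => [[g [[x Xx]|h]] b] /=; last first.
  by exists (if b then hinv h else h); rewrite /step_val; case: b.
have [i _ xE] := set_mem Xx; exists i, b; rewrite /step_val /= -xE.
by case: b => //; exact/esym/(elt_inv [:: (inr i, false)]).
Qed.

Lemma moves_by_step s : adm s.1 ->
  moves_by (normal_form (step_start src tgt s)) (normal_form (step_stop src tgt s)) 1.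
Proof.
move=> As; rewrite step_stopE normal_formM; have := step_valP s.
case: s As => [[g [c|h]] b] As /= [].
  by move=> i [b' ->]; rewrite state_actE; apply: moves_by_c.
move=> h' ->; rewrite state_act_h.
(* An empty stack would put the start of the edge in $H$, and hence the edge in $\Gamma(H,H)$. *)
apply: moves_by_h => Ex; apply: As; set u := step_start _ _ _ in Ex.
have Hu : H u.
  rewrite -(normal_form_val u) -(hstate_val_to_h) /hstate_val Ex /= mul1g.
  exact: hvalP.
have Hh : H (hval h) by exact: hvalP.
split; first by exists h.
  move: Hu; rewrite /u /step_start; case: (b) => //=; rewrite /cayley_tgt /= => Hu.
  by rewrite -(mulgK (hval h) g); apply: subgroup_abM => //; apply: subgroup_abV.
move: Hu; rewrite /u /step_start; case: (b) => //=; rewrite /cayley_tgt /= => Hu.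
exact: subgroup_abM.
Qed.

Lemma moves_by_walk u p v :
  walk adm u p v -> moves_by (normal_form u) (normal_form v) (size p).
Proof.
elim: p u => [|s p IH] u /=; first by move=> -> z ->; exists z; rewrite // subrr.
move=> [As <- /IH pv] z /(moves_by_step As)[z1 /pv[z2 z2E l2] l1].
by exists z2 => //; lia.
Qed.

Lemma normal_form_h (h : H) : normal_form (hval h) = of_h (EmptyStack, h).
Proof.
rewrite /normal_form state_act_h /act_h to_h_origin /=; congr (of_h (_, _)).
by apply: hval_inj; rewrite hvalM mul1g.
Qed.

Lemma potential_comm k : potential (normal_form (expgz w k)) = Some (- k * M%:Z).
Proof.
have -> : expgz w k = hval (p_uncoord (None, k)) by rewrite hval_uncoord mul1g.
rewrite normal_form_h /of_h; cbn [fst snd]; rewrite p_uncoordK.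
by rewrite /potential /= /q_uncoord /orbit_uncoord /= axis_rho_vertex.
Qed.

Lemma potential_h (h : H) : potential (normal_form (hval h)) <> None ->
  exists k, hval h = expgz w k.
Proof.
rewrite -(p_coordK h) normal_form_h /of_h; cbn [fst snd]; rewrite p_uncoordK.
by case: (p_coord h) => [[r|] k] //= _; exists k; rewrite hval_uncoord mul1g.
Qed.

Variable R : realType.

(** Above by the path of [comm_walk]; below because an admissible step changes the potential by at
    most 1, and $w^k$ has potential $-2mk$. *)
Lemma relative_dist_comm k :
  relative_dist R X H 1%g (expgz w k) = (2 * m * `|k|)%:R%:E.
Proof.
rewrite mul2n; apply/le_anti/andP; split.
  have [p [sp pw]] := comm_walk k 1%g.
  by rewrite -sp; apply: walk_dist_le; rewrite mul1g in pw.
apply: walk_dist_ge => p /moves_by_walk mp.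
rewrite lee_fin ler_nat.
have [|z] := mp 0; first by rewrite -[1%g]/(expgz w 0) potential_comm oppr0 mul0r.
by rewrite potential_comm => -[<-]; rewrite subr0 mulNr normrN -abszE abszM mulnC.
Qed.

(** An admissible path from 1 would keep the potential defined up to [h], which by [potential_h]
    would then be a power of $w$. *)
Lemma relative_dist_oo h : (H `\` generated [set w]) h ->
  relative_dist R X H 1%g h = +oo%E.
Proof.
move=> [Hh Ch]; apply: walk_dist_oo => p /moves_by_walk mp.
have [|z zE _] := mp 0; first by rewrite -[1%g]/(expgz w 0) potential_comm oppr0 mul0r.
have [|k hk] := @potential_h (hmk Hh); first by rewrite (_ : hval _ = h) ?zE.
by apply: Ch; rewrite -[h]/(hval (hmk Hh)) hk; apply: generated_expgz.
Qed.

Lemma relative_ball_finite h (r : R) : H h ->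
  finite_set [set k | H k /\ (relative_dist R X H h k <= r%:E)%E].
Proof.
(* For negative [r] the ball is empty, so the absolute value does no harm. *)
move=> Hh; pose N := `|Num.ceil r|%N.
apply: (@sub_finite_set _ _
  ((fun j : int => h * expgz w j)%g @` [set j : int | `|j| <= N%:Z])).
  move=> k [Hk].
  have -> : relative_dist R X H h k = relative_dist R X H 1%g (h^-1 * k)%g.
    rewrite -(relative_dist_translate X R 1%g (h^-1 * k)%g (subgroup_ab_subgroup n) Hh).
    by rewrite mulg1 mulVKg.
  have Hu : H (h^-1 * k)%g by apply: subgroup_abM => //; apply: subgroup_abV.
  case: (pselect (generated [set w] (h^-1 * k)%g)) => [|Cu]; last first.
    by rewrite relative_dist_oo.
  move=> /generated1P[j jE]; rewrite jE; rewrite relative_dist_comm lee_fin => le_jr.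
  exists j => /=; last by rewrite -jE mulVKg.
  rewrite /N.
  have : (`|j|%N%:R : R) <= (Num.ceil r)%:~R.
    apply: le_trans (ceil_ge r); apply: le_trans le_jr.
    by rewrite ler_nat leq_pmull.
  rewrite -[X in X <= _]/((`|j|%N : int)%:~R) ler_int abszE; lia.
apply/finite_image/(@sub_finite_set _ _
  ((fun i : nat => i%:Z - N%:Z) @` `I_(N + N).+1)).
  move=> j jN; exists (absz (j + N%:Z)); move: jN; rewrite /= ?ltnS; lia.
exact/finite_image/finite_II.
Qed.

End RelativeMetric.

(** * Hyperbolicity from a combing *)

Section ListTree.
Variable L : Type.
Implicit Types s t u v : seq L.

(** Lists grow at their head, so the ancestors of a node are its suffixes. *)
Definition extends t u := exists v, u = v ++ t.

Lemma extends_refl u : extends u u. Proof. by exists [::]. Qed.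
Lemma extends_nil u : extends [::] u. Proof. by exists u; rewrite cats0. Qed.

Lemma extends_trans t u v : extends t u -> extends u v -> extends t v.
Proof. by move=> [x ->] [y ->]; exists (y ++ x); rewrite catA. Qed.

Lemma extends_cons x u : extends u (x :: u).
Proof. by exists [:: x]. Qed.

Lemma extends_consP t x u : extends t (x :: u) -> t = x :: u \/ extends t u.
Proof. by case=> [[|y v]] /= [] => [<-|_ ->]; [left|right; exists v]. Qed.

Lemma extends_anti t u : extends t u -> extends u t -> t = u.
Proof.
move=> [x ->] [y /(congr1 size)]; rewrite !size_cat => E.
suff: size x = 0%N by case: x {E}.
by lia.
Qed.

Lemma extends_total s t u : extends s u -> extends t u -> extends s t \/ extends t s.
Proof.
elim: u => [|x u IH] su tu.
  by case: su => -[|? ?] //= <-; left; apply: extends_nil.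
have [->|{}su] := extends_consP su; first by right.
have [->|{}tu] := extends_consP tu; last exact: IH.
by left; apply: extends_trans su (extends_cons x u).
Qed.

(** This [t] is the branch point of the tree geodesic from [u] to [v]. *)
Lemma longest_common_ext u v : exists t, [/\ extends t u, extends t v &
  forall s, extends s u -> extends s v -> extends s t].
Proof.
elim: u => [|x u [t [tu tv tmax]]].
  by exists [::]; split=> //; apply: extends_nil.
have [xv|nxv] := pselect (extends (x :: u) v).
  by exists (x :: u); split=> //; apply: extends_refl.
exists t; split=> //; first exact: extends_trans tu (extends_cons x u).
by move=> s /extends_consP[->|su sv]; [|exact: tmax].
Qed.

Definition adjacent u v := exists x, u = x :: v \/ v = x :: u.

Inductive chain (A : seq L -> Prop) : seq L -> seq L -> Prop :=
| chain_nil u : A u -> chain A u u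
| chain_cons u u' v : A u -> adjacent u u' -> chain A u' v -> chain A u v.

Lemma chain_trans A u v t : chain A u v -> chain A v t -> chain A u t.
Proof. by elim=> // {}u u' {}v Au uu' _ IH /IH; apply: chain_cons. Qed.

Lemma chain_mono (A B : seq L -> Prop) u v : (forall l, A l -> B l) ->
  chain A u v -> chain B u v.
Proof.
move=> AB; elim=> [{}u /AB|{}u u' {}v /AB Bu uu' _]; first exact: chain_nil.
exact: chain_cons.
Qed.

Lemma chain_edge (A : seq L -> Prop) u v :
  A u -> A v -> adjacent u v -> chain A u v.
Proof. by move=> Au Av uv; apply: chain_cons uv (chain_nil Av). Qed.

Lemma chain_sym A u v : chain A u v -> chain A v u.
Proof.
elim=> [{}u|{}u u' {}v Au [x uu'] uv vu]; first exact: chain_nil.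
apply: chain_trans vu _; apply: chain_edge => //; last by exists x; case: uu'; auto.
by case: uv.
Qed.

(* t lies on the geodesic from u to v in the rooted tree of lists. *)
Definition separates t u v :=
  extends t u /\ forall s, extends s u -> extends s v -> extends s t.

(** Induction along the chain: as long as it has not reached [t], its next node is still separated
    from [v] by [t]. *)
Lemma chain_separates A u v t : chain A u v -> separates t u v -> A t.
Proof.
elim=> [{}u Au|{}u u' {}v Au uu' _ IH] [tu tmax].
  by rewrite (extends_anti tu (tmax u (extends_refl u) (extends_refl u))).
have [->//|ne] := pselect (t = u); apply: IH.
case: uu' => x [uE|uE]; subst.
  have [//|tu'] := extends_consP tu.
  split=> // s su' sv; apply: tmax sv.
  exact: extends_trans su' (extends_cons x u').
split=> [|s /extends_consP[-> xv|]]; last exact: tmax.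
  exact: extends_trans tu (extends_cons x u).
case: ne; apply: extends_anti tu _; apply: tmax; first exact: extends_refl.
exact: extends_trans (extends_cons x u) xv.
Qed.

End ListTree.

(** * The integral distance between vertices of a Cayley graph *)

Section CayleyDistance.
Variables (G : groupType) (X H : set G).
Local Notation src := (@cayley_src G X H).
Local Notation tgt := (@cayley_tgt G X H).
Local Notation walk := (walk src tgt).
Hypothesis connected : forall u v : G, exists p, walk setT u p v.

Let has_walk (u v : G) : exists k, `[< exists p, size p = k /\ walk setT u p v >].
Proof. by have [p pw] := connected u v; exists (size p); apply/asboolP; exists p. Qed.

Definition dist u v : nat := ex_minn (has_walk u v).

Lemma dist_walk u v : exists p, size p = dist u v /\ walk setT u p v.
Proof. by rewrite /dist; case: ex_minnP => k /asboolP. Qed.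

Lemma dist_le u v p : walk setT u p v -> (dist u v <= size p)%N.
Proof.
move=> pw; rewrite /dist; case: ex_minnP => k _; apply.
by apply/asboolP; exists p.
Qed.

Lemma distxx u : dist u u = 0%N.
Proof. by apply/eqP; rewrite -leqn0; apply: (@dist_le u u [::]). Qed.

Lemma dist_triangle v u x : (dist u x <= dist u v + dist v x)%N.
Proof.
have [p [<- pw]] := dist_walk u v; have [q [<- qw]] := dist_walk v x.
by rewrite -size_cat; apply/dist_le/(walk_cat pw qw).
Qed.

Lemma dist_sym u v : dist u v = dist v u.
Proof.
suff le x y : (dist x y <= dist y x)%N by apply/eqP; rewrite eqn_leq !le.
have [p [<- pw]] := dist_walk y x; have := dist_le (walk_rev pw).
by rewrite size_rev size_map.
Qed.

Lemma dist_translate g u v : dist (g * u)%g (g * v)%g = dist u v.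
Proof.
suff le h x y : (dist (h * x)%g (h * y)%g <= dist x y)%N.
  apply/eqP; rewrite eqn_leq le /= -{1}(mulKg g u) -{1}(mulKg g v); exact: le.
have [p [<- pw]] := dist_walk x y; rewrite -(size_map (translate_step h)).
exact/dist_le/(walk_translate _ pw).
Qed.

Lemma dist_walk_distE (R : realType) u v :
  walk_dist R src tgt setT u v = (dist u v)%:R%:E.
Proof.
apply/le_anti/andP; split.
  by have [p [<- pw]] := dist_walk u v; apply: walk_dist_le.
by apply: walk_dist_ge => p /dist_le; rewrite lee_fin ler_nat.
Qed.

(** * The four-point condition from a map to a tree *)

Section Combing.
Variables (L : Type) (lval : seq L -> G) (nf : G -> seq L) (D : nat).
Hypothesis nfK : cancel nf lval.
Hypothesis nf_step : forall s,
  chain (fun l => (dist (step_start src tgt s) (lval l) <= D)%N)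
    (nf (step_start src tgt s)) (nf (step_stop src tgt s)).
Hypothesis nf_root : chain (fun l => (dist 1%g (lval l) <= D)%N) (nf 1%g) [::].

(** The first condition puts [z] on a geodesic from [x] to [y]. *)
Let near x y (l : seq L) := exists2 z,
  (dist x z + dist z y <= dist x y)%N & (dist z (lval l) <= D)%N.

Lemma combing_near x y : chain (near x y) (nf x) (nf y).
Proof.
(* Stated for arbitrary walks, with length in place of distance, to allow induction; a geodesic is
   taken at the end. *)
have walk_chain p u : walk setT u p y ->
    chain (fun l => exists2 z, (dist u z + dist z y <= size p)%N &
      (dist z (lval l) <= D)%N) (nf u) (nf y).
  elim: p u => [|s p IH] u /=.
    move=> <-; apply: chain_nil; exists u; first by rewrite !distxx.
    by rewrite nfK distxx.
  move=> [_ <- pw].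
  have step1 : (dist (step_start src tgt s) (step_stop src tgt s) <= 1)%N.
    by apply: (@dist_le _ _ [:: s]).
  apply: (@chain_trans _ _ _ (nf (step_stop src tgt s))).
    apply: chain_mono (nf_step s) => l lD; exists (step_start src tgt s) => //.
    rewrite distxx add0n; apply: leq_trans (dist_triangle (step_stop src tgt s) _ _) _.
    by have := dist_le pw; lia.
  apply: chain_mono (IH _ pw) => l [z zp zl]; exists z => //.
  have := dist_triangle (step_stop src tgt s) (step_start src tgt s) z; lia.
have [p [pE pw]] := dist_walk x y.
by apply: chain_mono (walk_chain _ _ pw) => l; rewrite pE.
Qed.

Lemma combing_separates x y t : separates t (nf x) (nf y) ->
  (dist x (lval t) + dist (lval t) y <= dist x y + 2 * D)%N.
Proof.
move=> /(chain_separates (combing_near x y))[z zxy zt].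
have := dist_triangle z x (lval t); have := dist_triangle z (lval t) y.
by rewrite (dist_sym (lval t) z); lia.
Qed.

(** Every ancestor of [nf x] separates it from the root, and [nf_root] joins the root to [nf 1] near
    1. *)
Lemma combing_extends x t : extends t (nf x) ->
  (dist x (lval t) + dist (lval t) 1%g <= dist x 1%g + 2 * D)%N.
Proof.
move=> tx; have C : chain (near x 1%g) (nf x) [::].
  apply: chain_trans (combing_near x 1%g) _.
  by apply: chain_mono nf_root => l lD; exists 1%g; rewrite // distxx addn0.
have [|z zxy zt] := chain_separates C (t := t).
  by split=> // s _ [[|//] /= <-]; apply: extends_nil.
have := dist_triangle z x (lval t); have := dist_triangle z (lval t) 1%g.
by rewrite (dist_sym (lval t) z); lia.
Qed.

Let gp w x y : int := (dist x w)%:Z + (dist y w)%:Z - (dist x y)%:Z.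

(** Here [gp] is twice the Gromov product. The branch points of [x], [y] and of [y], [z] are both
    ancestors of [nf y], hence comparable, and the higher one is an ancestor of both [nf x] and
    [nf z]. A branch point bounds [gp] from above up to $2D$, a common ancestor from below up to
    $4D$. *)
Lemma combing_four_points w x y z :
  Num.min (gp w x y) (gp w y z) - (6 * D)%:Z <= gp w x z.
Proof.
wlog -> : w x y z / w = 1%g.
  move=> /(_ 1%g (w^-1 * x) (w^-1 * y) (w^-1 * z))%g /(_ erefl).
  by rewrite /gp -(mulVg w) !dist_translate.
have upper u v t : extends t (nf u) -> extends t (nf v) ->
    (forall s, extends s (nf u) -> extends s (nf v) -> extends s t) ->
    gp 1%g u v <= (2 * (dist (lval t) 1%g + D))%N%:Z.
  move=> tu tv tmax; have := @combing_separates u v t (conj tu tmax).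
  have := dist_triangle (lval t) u 1%g; have := dist_triangle (lval t) v 1%g.
  by rewrite /gp (dist_sym v (lval t)); lia.
have lower t : extends t (nf x) -> extends t (nf z) ->
    (2 * dist (lval t) 1%g)%N%:Z - (4 * D)%N%:Z <= gp 1%g x z.
  move=> tx tz; have := combing_extends tx; have := combing_extends tz.
  have := dist_triangle (lval t) x z.
  by rewrite /gp (dist_sym z (lval t)); lia.
have [t [tx ty tmax]] := longest_common_ext (nf x) (nf y).
have [s [sy sz smax]] := longest_common_ext (nf y) (nf z).
have := upper _ _ _ tx ty tmax; have := upper _ _ _ sy sz smax.
have [ts|st] := extends_total ty sy.
  by have := lower _ tx (extends_trans ts sz); lia.
by have := lower _ (extends_trans st tx) sz; lia.
Qed.

Variable R : realType.

Let point_vertex (p : cayley_point R X H) : G :=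
  match p with Vertex v => v | Inside e _ => cayley_src e end.

Lemma point_endsP p x : point_ends src tgt p x ->
  (dist (point_vertex p) x.1 <= 1)%N /\ 0 <= x.2 <= 1.
Proof.
case: p => [v|e t] /=; first by move=> ->; rewrite distxx lexx ler01.
have := set_mem (valP t); rewrite /= in_itv /= => /andP[t0 t1].
case=> -> /=; first by rewrite distxx (ltW t0) (ltW t1).
split; last by apply/andP; split; lra.
by apply: (@dist_le _ _ [:: (e, false)]).
Qed.

Lemma point_dist_bounds p q :
  (((dist (point_vertex p) (point_vertex q))%:R - 2)%:E
    <= point_dist src tgt p q
    <= ((dist (point_vertex p) (point_vertex q))%:R + 2)%:E)%E.
Proof.
apply/andP; split.
  apply: le_ereal_inf_tmp => z [[x px] [y qy] <-|].
    have [dx x2] := point_endsP px; have [dy y2] := point_endsP qy.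
    rewrite dist_walk_distE -!EFinD lee_fin.
    have : (dist (point_vertex p) (point_vertex q) <= 2 + dist x.1 y.1)%N.
      have := dist_triangle x.1 (point_vertex p) (point_vertex q).
      have := dist_triangle y.1 x.1 (point_vertex q).
      by rewrite (dist_sym y.1); lia.
    rewrite -(ler_nat R) natrD; lra.
  case: p q => [?|e s] [?|f t] //= [<- ->].
  rewrite lee_fin distxx; have := normr_ge0 (val s - val t); lra.
have vertex_end r : exists2 x, point_ends src tgt r x &
    x.1 = point_vertex r /\ 0 <= x.2 <= 1.
  case: r => [v|e t] /=; first by exists (v, 0) => //=; rewrite lexx ler01.
  have := set_mem (valP t); rewrite /= in_itv /= => /andP[t0 t1].
  by exists (src e, val t); [left|rewrite /= (ltW t0) (ltW t1)].
have [x px [<- x2]] := vertex_end p; have [y qy [<- y2]] := vertex_end q.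
apply: (@le_trans _ _ (x.2 + (dist x.1 y.1)%:R + y.2)%:E); last by rewrite lee_fin; lra.
by apply: ereal_inf_lbound; left; exists x => //; exists y => //;
  rewrite dist_walk_distE.
Qed.

Lemma cayley_dist_bounds p q :
  `|cayley_dist p q - (dist (point_vertex p) (point_vertex q))%:R| <= 2.
Proof.
have := point_dist_bounds p q; rewrite /cayley_dist.
(* The bounds exclude infinite values, so [fine] never takes its default. *)
case: (point_dist _ _ _ _) => [z||] /=.
- by rewrite !lee_fin => ?; rewrite ler_distl; lra.
- by rewrite andbF.
- by [].
Qed.

Lemma combing_hyperbolic : gromov_hyperbolic (@cayley_dist R G X H).
Proof.
(* Halving gives $3D$. A Gromov product is half a combination of three distances, each known up to
   2, so each of the two products compared has error at most 3. *)
exists ((3 * D)%:R + 6); first by rewrite addr_ge0.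
move=> w x y z; rewrite /gromov_product.
have := cayley_dist_bounds x w; have := cayley_dist_bounds y w.
have := cayley_dist_bounds z w; have := cayley_dist_bounds x y.
have := cayley_dist_bounds y z; have := cayley_dist_bounds x z.
rewrite !ler_distl natrM => ? ? ? ? ? ?.
have := combing_four_points (point_vertex w) (point_vertex x) (point_vertex y)
  (point_vertex z).
rewrite /gp !lerBlDr !ge_min => /orP[]; rewrite -(ler_int R);
  rewrite !(rmorphD, rmorphB, rmorphN, rmorphM) /= => ?; apply/orP; [left|right]; lra.
Qed.
End Combing.
End CayleyDistance.

(** * The combing of the surface group *)

Section SurfaceCombing.
Variable n : nat.
Local Notation m := n.+2.
Local Notation M := (m.*2).
Local Notation G := (surface_group m).
Local Notation w := (comm_ab n).
Local Notation H := (@subgroup_ab n).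
Local Notation X := (range (@surface_c m)).
Local Notation src := (@cayley_src G X H).
Local Notation tgt := (@cayley_tgt G X H).
Local Notation walk := (walk src tgt).
Local Notation P' := (orbit_index (@pshift n) (@punshift n) (@hone n)).
Local Notation Q' := (orbit_index (@axis_unshift n) (@axis_shift n) (qone n)).

Lemma h_walk (g : G) (h : H) : walk setT g [:: ((g, inr h), false)] (g * hval h)%g.
Proof. by []. Qed.

Lemma letter_walk (g : G) l :
  exists p, size p = 1%N /\ walk setT g p (g * elt [:: l])%g.
Proof.
case: l => [[e|i] b].
  have [h ->] : exists h : H, elt [:: (inl e, b)] = hval h.
    case: b; last by exists (h_letter n e); case: e.
    exists (hinv (h_letter n e)); rewrite hvalV.
    by rewrite -[LHS]/(elt (word_inv [:: (inl e, false)])) elt_inv; case: e.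
  by exists [:: ((g, inr h), false)]; split=> //; exact: h_walk.
have [p [sp pw]] := c_walk g [:: (i, b)].
by exists p; split=> //; apply: walk_sub pw.
Qed.

Lemma surface_connected (u v : G) : exists p, walk setT u p v.
Proof.
rewrite -(mulVKg u v); have [t ->] := elt_surj (u^-1 * v)%g.
elim: t u => [|l t IH] g; first by exists [::]; rewrite /= mulg1.
have [p [_ pw]] := letter_walk g l; have [q qw] := IH (g * elt [:: l])%g.
by exists (p ++ q); apply: walk_cat pw _; rewrite -(cat1s l t) elt_cat mulgA.
Qed.

Local Notation dist := (dist surface_connected).

Lemma dist_letters (g : G) (u : seq ('I_m * bool)) :
  (dist g (g * elt [seq emb x | x <- u])%g <= size u)%N.
Proof.
by have [p [<- pw]] := c_walk g u; apply/dist_le/(walk_sub _ pw).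
Qed.

Lemma dist_h (g : G) (h : H) : (dist g (g * hval h)%g <= 1)%N.
Proof. exact: (dist_le _ (h_walk g h)). Qed.

Lemma dist_comm (g : G) k : (dist g (g * expgz w k)%g <= 1)%N.
Proof. by rewrite -[expgz w k]mul1g -(hval_uncoord None k) dist_h. Qed.

(** One edge labelled by a power of $w$ leads to the start of the period containing [i]; fewer than
    [M] letters remain. *)
Lemma dist_axis (g : G) i : (dist g (g * axis_elt n i)%g <= M.+1)%N.
Proof.
pose k := (i %/ M%:Z)%Z.
have -> : axis_elt n i =
    (expgz w (- k) * elt [seq emb x | x <- axis_word n (k * M%:Z) (phase n i)])%g.
  have := qval_rho (- k) (qone n).
  rewrite qval1 mul1g => <-.
  rewrite -qval_foldl -/(axis_walk _ _ _) axis_rho_vertex opprK axis_walk_vertex.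
  by rewrite phaseE -divz_eq.
rewrite mulgA; apply: leq_trans (dist_triangle _ (g * expgz w (- k))%g _ _) _.
apply: leq_trans (leq_add (dist_comm _ _) (dist_letters _ _)) _.
by rewrite size_map size_iota; have := phase_lt n i; lia.
Qed.

(** A label is a position on the axis, a letter of a branch off it, or a whole coset representative
    in $H$. *)
Definition syllable : Type := (int + ('I_m * bool) + P')%type.

Definition syllable_val (x : syllable) : G :=
  match x with
  | inl (inl i) => axis_elt n i
  | inl (inr l) => letter_elt l
  | inr r => p_val r
  end.

Definition list_val (l : seq syllable) : G :=
  foldr (fun x g => g * syllable_val x)%g 1%g l.

(* The vertices of the axis of <w> all become children of one node: they are close
   to each other in the Cayley graph, where <w> has diameter 1. *)
Definition q_list (q : axis_state n) : seq syllable :=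
  [seq inl (inr x) | x <- (sval q).2] ++ [:: inl (inl (sval q).1)].
Definition p_list (r : P') : seq syllable := [:: inr r].
Definition stack_list (s : stack P' Q') : seq syllable :=
  stack_cat p_list (fun r : Q' => q_list (sval r)) s.
Definition hstack_list (s : stack Q' P') : seq syllable :=
  stack_cat (fun r : Q' => q_list (sval r)) p_list s.
Definition state_list (x : state n) : seq syllable :=
  q_list x.2 ++ stack_list x.1.

Lemma list_val_q q l : list_val (q_list q ++ l) = (list_val l * qval q)%g.
Proof.
rewrite /q_list /qval; elim: (sval q).2 => [//|x v IH] /=.
by rewrite IH mulgA.
Qed.

Lemma stack_cat_val (S T : Type) (f : S -> seq syllable) (g : T -> seq syllable)
    (fv : S -> G) (gv : T -> G) (s : stack S T) :
  (forall r l, list_val (f r ++ l) = (list_val l * fv r)%g) ->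
  (forall r l, list_val (g r ++ l) = (list_val l * gv r)%g) ->
  list_val (stack_cat f g s) = stack_val fv gv s.
Proof.
elim: s f g fv gv => [//|{}S {}T s IH r] f g fv gv fE gE /=.
by rewrite fE (IH _ _ gv fv).
Qed.

Lemma list_val_stack s : list_val (stack_list s) = stack_val (@p_val n) (@q_val n) s.
Proof. by apply: stack_cat_val => // r l; apply: list_val_q. Qed.

Lemma list_val_hstack s : list_val (hstack_list s) = stack_val (@q_val n) (@p_val n) s.
Proof. by apply: stack_cat_val => // r l; apply: list_val_q. Qed.

Lemma list_val_state x : list_val (state_list x) = state_val x.
Proof. by rewrite /state_list list_val_q list_val_stack. Qed.

Local Notation chain_near g d := (chain (fun l => (dist g (list_val l) <= d)%N)).

Lemma chain_near_weaken g g' d d' u v : (dist g' g + d <= d')%N ->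
  chain_near g d u v -> chain_near g' d' u v.
Proof.
move=> le; apply: chain_mono => l gl.
by apply: leq_trans (dist_triangle _ g _ _) _; lia.
Qed.

Lemma dist_state_c x i b : (dist (state_val x) (state_val (act x (inr i, b))) <= 1)%N.
Proof. by rewrite state_val_act; exact: (dist_letters _ [:: (i, b)]). Qed.

(** Off the axis, and when leaving it, one label is added or removed. A move along the axis passes
    through the common parent, which is near by [dist_axis]. *)
Lemma chain_c x i b :
  chain_near (state_val x) M.+1 (state_list x) (state_list (act x (inr i, b))).
Proof.
have near_x : (dist (state_val x) (list_val (state_list x)) <= M.+1)%N.
  by rewrite list_val_state distxx.
have near_x' :
    (dist (state_val x) (list_val (state_list (act x (inr i, b)))) <= M.+1)%N.
  by rewrite list_val_state; apply: leq_trans (dist_state_c x i b) _.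
case: x near_x near_x' => s [[j [|y v]] hv] near_x near_x'; last first.
  apply: chain_edge => //; rewrite /act /state_list /q_list /=.
  by case: ifP => _; eexists; [left|right].
have root j' : adjacent (inl (inl j') :: stack_list s) (stack_list s).
  by eexists; left.
have near_root : (dist (state_val (s, exist _ (j, [::]) hv))
    (list_val (stack_list s)) <= M.+1)%N.
  by rewrite list_val_stack dist_sym dist_axis.
move: near_x near_x' near_root; rewrite /act /state_list /q_list /=.
case: ifP => _; [|case: ifP => _] => /= nx nx' nr.
- apply: chain_cons nx (root j) (chain_sym (chain_cons nx' (root _) (chain_nil nr))).
- apply: chain_cons nx (root j) (chain_sym (chain_cons nx' (root _) (chain_nil nr))).
- by apply: chain_edge => //; eexists; right.
Qed.

Lemma chain_word s q (u : seq ('I_m * bool)) :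
  chain_near (state_val (s, q)) (M.+1 + size u)
    (state_list (s, q)) (state_list (s, foldl (@axis_step n) q u)).
Proof.
elim: u q => [|[i b] u IH] q /=.
  by apply: chain_nil; rewrite list_val_state distxx.
apply: chain_trans (chain_near_weaken _ (chain_c (s, q) i b)) _.
  by rewrite distxx; lia.
apply: chain_near_weaken (IH _).
by have := dist_state_c (s, q) i b; rewrite /act /=; lia.
Qed.

Local Notation rho := (iterz (@axis_unshift n) (@axis_shift n)).

(** The bound is independent of [k]: all the intermediate $qw^j$ are within 1 of the start, and each
    period between them costs $2M+1$ by [chain_word]. *)
Lemma chain_rho s q k :
  chain_near (state_val (s, q)) (2 * M + 2)
    (state_list (s, q)) (state_list (s, rho k q)).
Proof.
have near_k j : (dist (state_val (s, q)) (state_val (s, rho j q)) <= 1)%N.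
  by rewrite /state_val /= qval_rho mulgA dist_comm.
have step j (u : seq ('I_m * bool)) : size u = M ->
    chain_near (state_val (s, q)) (2 * M + 2) (state_list (s, rho j q))
      (state_list (s, foldl (@axis_step n) (rho j q) u)).
  move=> su; apply: chain_near_weaken (chain_word s (rho j q) u).
  by have := near_k j; rewrite su; lia.
elim/int_rect: k => [|k IH|k IH].
- by apply: chain_nil; rewrite list_val_state distxx.
- apply: chain_trans IH _; rewrite (intS k) addrC (iterzS (@axis_shiftK n)).
  by apply: step; rewrite /word_inv size_rev !size_map size_iota.
- apply: chain_trans IH _; rewrite (intS k) opprD addrC.
  rewrite (iterzP (@axis_unshiftK n) (@axis_shiftK n)).
  by apply: step; rewrite size_map size_iota.
Qed.

(** The node of [s] serves as a hub for a whole coset of $H$. A nontrivial representative lies two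
    labels below it; for $p=w^k$ the hub is the root, one label away, or the list ending in the
    popped syllable $r$, joined to that of $rw^k$ by [chain_rho]. *)
Lemma chain_h_end s p :
  chain_near (hstate_val (s, p)) (2 * M + 3) (state_list (of_h (s, p))) (hstack_list s).
Proof.
have near_s : (dist (hstate_val (s, p)) (list_val (hstack_list s)) <= 2 * M + 3)%N.
  by rewrite list_val_hstack dist_sym; apply: leq_trans (dist_h _ _) _; lia.
have near_x :
    (dist (hstate_val (s, p)) (list_val (state_list (of_h (s, p)))) <= 2 * M + 3)%N.
  by rewrite list_val_state state_val_of_h distxx.
have base k : q_uncoord (None, k) = axis_vertex n (- k * M%:Z) by exact: axis_rho_vertex.
case E : (p_coord p) => [o k]; have pE := p_coordK p; rewrite E in pE.
move: near_s near_x; rewrite -{}pE {E p} /of_h; cbn [fst snd]; rewrite p_uncoordK.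
case: o => [r|] near_s.
  have -> : exchange (s, (Some r, k)) = (Push s r, (None, k)) by case: (s).
  cbn [fst snd]; rewrite base => near_x.
  apply: (@chain_cons _ _ _ (inr r :: hstack_list s) _ near_x).
    by exists (inl (inl (- k * M%:Z))); left.
  apply: chain_edge => //; last by exists (inr r); left.
  rewrite -[list_val _]/(list_val (hstack_list s) * p_val r)%g list_val_hstack.
  rewrite /hstate_val; cbn [fst snd]; rewrite hval_uncoord mulgA dist_sym.
  by apply: leq_trans (dist_comm _ _) _; lia.
case: s near_s => [|s r] near_s; cbn [exchange fst snd]; rewrite ?base => near_x.
  by apply: chain_edge => //; exists (inl (inl (- k * M%:Z))); left.
apply: chain_sym; apply: chain_near_weaken (chain_rho s (sval r) k).
rewrite -[state_val _]/(stack_val (@q_val n) (@p_val n) (Push s r)).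
rewrite /hstate_val; cbn [fst snd]; rewrite hval_uncoord mul1g dist_sym.
by have := dist_comm (stack_val (@q_val n) (@p_val n) (Push s r)) k; lia.
Qed.

Lemma chain_h x h : chain_near (state_val x) (2 * M + 4)
  (state_list x) (state_list (act_h x h)).
Proof.
rewrite -{2}(to_hK x) -(hstate_val_to_h x) /act_h; case: (to_h x) => s p /=.
apply: chain_trans (chain_near_weaken _ (chain_h_end s p)) _.
  by rewrite distxx; lia.
apply: chain_sym; apply: chain_near_weaken (chain_h_end s (hmul p h)).
rewrite /hstate_val; cbn [fst snd]; rewrite hvalM mulgA.
by apply: leq_trans (leq_add (dist_h _ _) (leqnn _)) _; lia.
Qed.

Definition surface_list (g : G) : seq syllable := state_list (normal_form g).

Lemma surface_listK : cancel surface_list list_val.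
Proof. by move=> g; rewrite /surface_list list_val_state normal_form_val. Qed.

Lemma surface_list_step s :
  chain_near (step_start src tgt s) (2 * M + 4)
    (surface_list (step_start src tgt s)) (surface_list (step_stop src tgt s)).
Proof.
rewrite step_stopE /surface_list normal_formM; have := step_valP s.
rewrite -{1}(normal_form_val (step_start src tgt s)).
case: (s.1.2) => _ [].
  move=> i [b ->]; rewrite state_actE.
  by apply: chain_near_weaken (chain_c _ i b); rewrite distxx; lia.
by move=> h ->; rewrite state_act_h; apply: chain_h.
Qed.

Lemma surface_list_root :
  chain_near 1%g (2 * M + 4) (surface_list 1%g) [::].
Proof.
rewrite /surface_list /normal_form state_act1.
apply: chain_edge; last by exists (inl (inl 0)); left.
  by rewrite list_val_state /state_val /= mulg1 distxx.
by rewrite distxx.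
Qed.

Lemma surface_embedded (R : realType) : hyperbolically_embedded R X H.
Proof.
split.
- exact: subgroup_ab_subgroup.
- apply/seteqP; split=> // x _; have [u ->] := elt_surj x.
  have [G1 GM GV] := generated_subgroup (X `|` H).
  elim: u => [|l u IH]; first exact: G1.
  rewrite -(cat1s l u) elt_cat; apply: (GM _ _ _ IH).
  have gen s : generated (X `|` H) (elt [:: (s, false)]).
    apply: generated_mem; case: s => [[|]|i].
    - by right; apply: subgroup_ab_b.
    - by right; apply: subgroup_ab_a.
    - by left; exists i.
  case: l => s [|]; last exact: gen.
  by rewrite -[elt _]/(elt (word_inv [:: (s, false)])) elt_inv; apply: GV.
- exact: (combing_hyperbolic surface_listK surface_list_step surface_list_root).
- by move=> h r Hh; apply: relative_ball_finite.
Qed.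

End SurfaceCombing.

Theorem proposition4p3 (R : realType) (g m : nat)
    (hg : (4 <= g)%N) (hm : m = (g - 2)%N) :
  let a := surface_a m in
  let b := surface_b m in
  let H : set (surface_group m) := generated [set a; b] in
  let w := (a * b * a^-1 * b^-1)%g in
  let C : set (surface_group m) := generated [set w] in
  let X : set (surface_group m) := range (@surface_c m) in
  [/\ hyperbolically_embedded R X H,
      forall k : int,
        relative_dist R X H 1%g (expgz w k) = (2 * m * `|k|)%:R%:E
    & forall h, (H `\` C) h -> relative_dist R X H 1%g h = +oo%E].
Proof.
have [n ->] : exists n, m = n.+2 by exists (m - 2)%N; lia.
split; first exact: surface_embedded.
- exact: relative_dist_comm.
- exact: relative_dist_oo.
Qed.
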